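(* Let $G$ be finite and $z\in\mathbb C\setminus\{-1,0,1\}$. Consider the linear maps (a) $\mu\mapsto f_\mu$, $f_\mu(e)=\mu(\bar e)$, from $\{\mu\in\mathrm{FA}(P):\mathcal T'\mu=z\mu\}$ to $\mathrm{Eq}(S,z\,\mathrm{Id})$; (b) $I:\mathrm{Eq}(S,z\,\mathrm{Id})\to\mathrm{Eq}(\Sigma,R_z)=\mathrm{Eq}(\Delta,L_z)$; (c) the lift $f\mapsto f\circ\mathrm{pr}$ from $\mathrm{Eq}(\Sigma,R_z)$ to the $\Gamma$-invariant elements of $\mathrm{Eq}(\Sigma_{\mathbb T},R^{\mathbb T}_z)$; (d) $\mathrm{Res}$ from $\{\mu\in\mathrm{FA}(P):\mathcal T'\mu=z\mu\}$ to $\mathrm{FA}(\partial\mathbb T)^{\Gamma,z}$; (e) the Poisson transform $\mathcal P_z$ from $\mathrm{FA}(\partial\mathbb T)^{\Gamma,z}$ to the $\Gamma$-invariant elements of $\mathrm{Eq}(\Sigma_{\mathbb T},R^{\mathbb T}_z)$. Each of these maps is a linear isomorphism, and the diagram commutes: for every $\mu\in\mathrm{FA}(P)$ with $\mathcal T'\mu=z\mu$, $$(I f_\mu)\circ\mathrm{pr}=\mathcal P_z(\mathrm{Res}\,\mu).$$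
   Context: $G$ is a finite connected graph with vertex set $V$ (no loops, no multiple edges, every vertex of degree $\ge2$), $\deg v=1+q(v)$; $E$ oriented edges, $\iota,\tau$, opposite $\bar e$; turn $e\rightsquigarrow e'$ iff $\tau(e)=\iota(e')$, $e'\ne\bar e$. $P$ = infinite paths $(e_1,e_2,\dots)$ with $e_i\rightsquigarrow e_{i+1}$; $(\mathcal Tf)(e_1,\dots)=\sum_{e_0\rightsquigarrow e_1}f(e_0,e_1,\dots)$. Postal codes: finite paths $c=(c_1,\dots,c_m)$, $m\ge1$, $c_i\rightsquigarrow c_{i+1}$; district $P_c$; $\mathbf 1_c$ its indicator. $\mathrm{FA}(P)=\{\mu:\{\text{postal codes}\}\to\mathbb C:\mu(c)=\sum_{e:c_m\rightsquigarrow e}\mu(c,e)\}$; $\langle f,\mu\rangle=\sum_{|c|=m}f(c)\mu(c)$ for $f$ constant on districts of length $m$; $(\mathcal T'\mu)(c)=\langle\mathcal T\mathbf 1_c,\mu\rangle$. On $G$: $(Sg)(e)=\sum_{e'\rightsquigarrow e}g(e')$; $(\Sigma f)(v)=\sum_{w\text{ adj. }v}f(w)$; $(\Delta f)(v)=\frac1{1+q(v)}(\Sigma f)(v)$; $R_z$, $L_z$ multiplication by $z+q(v)z^{-1}$ resp. $\frac{z+z^{-1}q(v)}{1+q(v)}$; $(Ig)(v)=\sum_{\tau(e)=v}g(e)$; $\mathrm{Eq}(A,B)=\{f:Af=Bf\}$. Universal cover: fix $v_0\in V$; $\mathbb T$ is the tree whose vertices are non-backtracking finite edge paths in $G$ from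 $v_0$ (base vertex $o$ = empty path), each path adjacent to its one-edge extensions; $\mathrm{pr}$ sends a path to its terminal vertex; $\Gamma=\pi_1(G,v_0)$ acts by deck transformations. $\Sigma_{\mathbb T}$, $R^{\mathbb T}_z$ are the analogous operators on functions on vertices of $\mathbb T$ (with $q$ computed in $\mathbb T$, equal to $q$ of the image in $G$). $\partial\mathbb T$ = ends of $\mathbb T$, identified with $P_{v_0}=\{p\in P:\iota(e_1)=v_0\}$; clopen sets are finite disjoint unions of districts $P_c$ with $c$ starting at $v_0$; $\mathrm{FA}(\partial\mathbb T)$ = finitely additive complex set functions on clopen sets, locally constant functions being integrated by finite sums over clopen partitions. $(\mathrm{Res}\,\mu)(P_c)=\mu(c)$ for $c$ starting at $v_0$. With $d$ the tree metric, for an end $\omega$ and vertices $x,y$: $h_\omega(x,y)=d(x,w)-d(y,w)$ for any $w$ on both rays from $x$ and $y$ to $\omega$; horocycle bracket $\langle x,\omega\rangle:=h_\omega(o,x)$. Poisson transform: $(\mathcal P_z\nu)(x)=\int_{\partial\mathbb T}z^{\langle x,\omega\rangle}\,d\nu(\omega)$ (the integrand is locally constant in $\omega$). Twisted action of $\gamma\in\mathrm{Aut}(\mathbb T)$: $(\gamma\nu)(A)=\nu(\gamma^{-1}A)$, $(\pi_z(\gamma)\nu)(A)=\int_Ac_\gamma\,d(\gamma\nu)$, $c_\gamma(\omega)=z^{h_\omega(\gamma o,o)}$; $\mathrm{FA}(\partial\mathbb T)^{\Gamma,z}=\{\nu:\pi_z(\gamma)\nu=\nu\ \forall\gamma\in\Gamma\}$.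 A function $F$ on vertices of $\mathbb T$ is $\Gamma$-invariant if $F(\gamma x)=F(x)$ for all $\gamma\in\Gamma$. *)

(* Defs.v *)
From HB Require Import structures.
From mathcomp Require Import all_boot all_algebra.
From mathcomp Require Import boolp classical_sets complex Rstruct.

Set Implicit Arguments.
Unset Strict Implicit.
Unset Printing Implicit Defensive.

Import GRing.Theory Num.Theory.
Local Open Scope ring_scope.

Notation CC := (complex Rdefinitions.R).

Section Graph.
Variables (V : finType) (adj : rel V) (v0 : V) (z : CC).

Definition isE (e : V * V) : bool := adj e.1 e.2.
Definition ebar (e : V * V) : V * V := (e.2, e.1).
Definition turn (e e' : V * V) : bool :=
  [&& isE e, isE e', e.2 == e'.1 & e' != ebar e].

Definition deg (v : V) : nat := #|[pred w | adj v w]|.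
Definition qC (v : V) : CC := (deg v)%:R - 1.

Definition Sop (g : V * V -> CC) (e : V * V) : CC :=
  \sum_(e' : V * V | turn e' e) g e'.
Definition Sigop (f : V -> CC) (v : V) : CC := \sum_(w : V | adj v w) f w.
Definition Delop (f : V -> CC) (v : V) : CC := (1 + qC v)^-1 * Sigop f v.
Definition Rz (f : V -> CC) (v : V) : CC := (z + qC v / z) * f v.
Definition Lz (f : V -> CC) (v : V) : CC :=
  ((z + z^-1 * qC v) / (1 + qC v)) * f v.
Definition Iop (g : V * V -> CC) (v : V) : CC :=
  \sum_(e : V * V | isE e && (e.2 == v)) g e.

Definition EqS (g : V * V -> CC) : Prop :=
  (forall e, ~~ isE e -> g e = 0) /\ (forall e, isE e -> Sop g e = z * g e).
Definition EqSig (f : V -> CC) : Prop := forall v, Sigop f v = Rz f v.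
Definition EqDel (f : V -> CC) : Prop := forall v, Delop f v = Lz f v.

Definition inP (p : nat -> V * V) : Prop := forall i, turn (p i) (p i.+1).
Definition code (c : seq (V * V)) : bool :=
  if c is e :: c' then isE e && path turn e c' else false.
Definition distP (c : seq (V * V)) (p : nat -> V * V) : Prop :=
  inP p /\ mkseq p (size c) = c.

(* FA(P): set functions on postal codes (encoded as functions on seq, zero
   off postal codes) satisfying finite additivity mu(c) = sum_{c_m ~> e} mu(c,e) *)
Definition FAP (mu : seq (V * V) -> CC) : Prop :=
  (forall c, ~~ code c -> mu c = 0) /\
  (forall c e0, code (rcons c e0) ->
     mu (rcons c e0) = \sum_(e : V * V | turn e0 e) mu (rcons (rcons c e0) e)).

Definition Top (f : (nat -> V * V) -> CC) (p : nat -> V * V) : CC :=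
  \sum_(e0 : V * V | turn e0 (p 0%N))
     f (fun n => if n is n'.+1 then p n' else e0).
Definition ind (c : seq (V * V)) (p : nat -> V * V) : CC :=
  if mkseq p (size c) == c then 1 else 0.
Definition constP (m : nat) (f : (nat -> V * V) -> CC) : Prop :=
  forall c, code c -> size c = m -> exists a, forall p, distP c p -> f p = a.
Definition fvalP (f : (nat -> V * V) -> CC) (c : seq (V * V)) : CC :=
  xget 0 (fun a => forall p, distP c p -> f p = a).
Definition pairP (f : (nat -> V * V) -> CC) (mu : seq (V * V) -> CC) : CC :=
  let m := xget 1%N (fun m => (0 < m)%N /\ constP m f) in
  \sum_(t : m.-tuple (V * V) | code t) fvalP f t * mu t.
Definition Tdual (mu : seq (V * V) -> CC) (c : seq (V * V)) : CC :=
  pairP (Top (ind c)) mu.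

Definition EigP (mu : seq (V * V) -> CC) : Prop :=
  FAP mu /\ forall c, code c -> Tdual mu c = z * mu c.

Definition fmu (mu : seq (V * V) -> CC) (e : V * V) : CC := mu [:: ebar e].

(* vertices: non-backtracking edge paths from v0 (the empty path is o) *)
Definition codeB (c : seq (V * V)) : bool :=
  if c is e :: _ then code c && (e.1 == v0) else false.
Definition tvert (x : seq (V * V)) : bool := (x == [::]) || codeB x.
Definition pr (x : seq (V * V)) : V := if x is e :: x' then (last e x').2 else v0.

(* Sigma_T: sum over the neighbours (children rcons x e, and parent) *)
Definition SigT (F : seq (V * V) -> CC) (x : seq (V * V)) : CC :=
  \sum_(e : V * V | tvert (rcons x e)) F (rcons x e)
  + (if x is e :: x' then F (belast e x') else 0).
Definition degT (x : seq (V * V)) : nat :=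
  (#|[pred e | tvert (rcons x e)]| + (x != [::]))%N.
Definition RzT (F : seq (V * V) -> CC) (x : seq (V * V)) : CC :=
  (z + ((degT x)%:R - 1) / z) * F x.

Definition EqSigT (F : seq (V * V) -> CC) : Prop :=
  (forall x, ~~ tvert x -> F x = 0) /\ (forall x, tvert x -> SigT F x = RzT F x).

(* Gamma = pi_1(G, v0), modelled as reduced closed edge paths at v0, acting on
   T by deck transformations x |-> reduced form of (gamma x). *)
Definition isLoop (g : seq (V * V)) : bool := tvert g && (pr g == v0).
Definition redc (e : V * V) (t : seq (V * V)) : seq (V * V) :=
  if t is e' :: t' then (if e' == ebar e then t' else e :: t) else [:: e].
Definition red (s : seq (V * V)) : seq (V * V) := foldr redc [::] s.
Definition actT (g x : seq (V * V)) : seq (V * V) := red (g ++ x).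

Definition GinvT (F : seq (V * V) -> CC) : Prop :=
  forall g x, isLoop g -> tvert x -> F (actT g x) = F x.

Definition liftpr (f : V -> CC) (x : seq (V * V)) : CC :=
  if tvert x then f (pr x) else 0.

(* ---------- the boundary dT = P_{v0} ---------- *)
Definition ray (p : nat -> V * V) : Prop := inP p /\ (p 0%N).1 = v0.
Definition distB (c : seq (V * V)) (p : nat -> V * V) : Prop :=
  ray p /\ mkseq p (size c) = c.
Definition bset := (nat -> V * V) -> Prop.

Definition clopen (A : bset) : Prop :=
  exists cs : seq (seq (V * V)),
    [/\ all codeB cs,
        (forall c1 c2, c1 \in cs -> c2 \in cs -> c1 != c2 ->
           forall p, distB c1 p -> distB c2 p -> False) &
        A = (fun p => exists2 c, c \in cs & distB c p)].

Definition FAB (nu : bset -> CC) : Prop :=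
  (forall A, ~ clopen A -> nu A = 0) /\
  (forall A B, clopen A -> clopen B -> (forall p, A p -> B p -> False) ->
     nu (fun p => A p \/ B p) = nu A + nu B).

(* integration of locally constant functions: finite sum over the clopen
   partition into districts of a length m on which the integrand is constant *)
Definition constB (m : nat) (f : (nat -> V * V) -> CC) : Prop :=
  forall c, codeB c -> size c = m -> exists a, forall p, distB c p -> f p = a.
Definition fvalB (f : (nat -> V * V) -> CC) (c : seq (V * V)) : CC :=
  xget 0 (fun a => forall p, distB c p -> f p = a).
Definition depB (f : (nat -> V * V) -> CC) : nat :=
  xget 1%N (fun m => (0 < m)%N /\ constB m f).
Definition bsum (m : nat) (f : (nat -> V * V) -> CC) (w : seq (V * V) -> CC) : CC :=
  \sum_(t : m.-tuple (V * V) | codeB t) fvalB f t * w t.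
Definition bint (f : (nat -> V * V) -> CC) (nu : bset -> CC) : CC :=
  bsum (depB f) f (fun c => nu (distB c)).
Definition indB (A : bset) (f : (nat -> V * V) -> CC) : (nat -> V * V) -> CC :=
  fun p => if `[< A p >] then f p else 0.

(* map (d): (Res mu)(P_c) = mu(c), extended additively to clopen sets *)
Definition Res (mu : seq (V * V) -> CC) (A : bset) : CC :=
  if `[< clopen A >] then bsum (depB (indB A (fun _ => 1))) (indB A (fun _ => 1)) mu
  else 0.

Fixpoint lcp (x y : seq (V * V)) : nat :=
  match x, y with
  | a :: x', b :: y' => if a == b then (lcp x' y').+1 else 0%N
  | _, _ => 0%N
  end.
Definition dT (x y : seq (V * V)) : nat := (size x + size y - 2 * lcp x y)%N.
(* h_omega(x,y) = d(x,w) - d(y,w), w the vertex of the ray to omega at depth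
   size x + size y (which lies on both rays from x and from y to omega) *)
Definition horo (p : nat -> V * V) (x y : seq (V * V)) : int :=
  let w := mkseq p (size x + size y) in (dT x w)%:Z - (dT y w)%:Z.
Definition hbr (x : seq (V * V)) (p : nat -> V * V) : int := horo p [::] x.

Definition Pz (nu : bset -> CC) (x : seq (V * V)) : CC :=
  if tvert x then bint (fun p => z ^ hbr x p) nu else 0.

(* action of gamma on ends: the ray which is the reduced form of gamma omega *)
Definition actE (g : seq (V * V)) (p : nat -> V * V) : nat -> V * V :=
  fun n => nth (p 0%N) (red (g ++ mkseq p (n + size g).+1)) n.
Definition actM (g : seq (V * V)) (nu : bset -> CC) : bset -> CC :=
  fun A => nu (fun p => ray p /\ A (actE g p)).
Definition cgam (g : seq (V * V)) (p : nat -> V * V) : CC :=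
  z ^ horo p (actT g [::]) [::].
Definition piz (g : seq (V * V)) (nu : bset -> CC) (A : bset) : CC :=
  bint (indB A (cgam g)) (actM g nu).

Definition FABinv (nu : bset -> CC) : Prop :=
  FAB nu /\ forall g, isLoop g -> forall A, clopen A -> piz g nu A = nu A.

End Graph.

Definition lin_iso (A B : Type) (P : (A -> CC) -> Prop) (Q : (B -> CC) -> Prop)
    (phi : (A -> CC) -> (B -> CC)) : Prop :=
  [/\ forall u, P u -> Q (phi u),
      forall (a : CC) u v, P u -> P v ->
        phi (fun t => a * u t + v t) = (fun t => a * phi u t + phi v t),
      forall u v, P u -> P v -> phi u = phi v -> u = v &
      forall w, Q w -> exists2 u, P u & phi u = w].

(* Main.v *)
Require Import Defs.
From HB Require Import structures.
From mathcomp Require Import all_boot all_algebra.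
From mathcomp Require Import boolp classical_sets complex Rstruct.
From mathcomp Require Import zify ring.
Import GRing.Theory Num.Theory.
Local Open Scope ring_scope.

(** An eigenmeasure satisfies mu(c_1, ..., c_m) = z^(1-m) mu(c_m), so it is the
    same thing as an edge function, and g in Eq(S, z) is recovered from f = I g
    by (z^2 - 1) g(e) = z f(iota e) - f(tau e).  Along an edge e leading from x
    to a child xe in the tree, the horocycle bracket grows by 1 on the district
    of xe and drops by 1 elsewhere, whence
      z P_z nu(xe) - P_z nu(x) = z^|x| (z^2 - 1) nu(P_xe),
    the same recursion as the one for I f_mu; this gives the commutative diagram.
    A deck transformation taking x to x' carries P_xe onto P_x'e, with constant
    density z^(|x| - |x'|), so for an invariant nu the number z^|x| nu(P_xe)
    depends on e only.  Every oriented edge ends some non-backtracking path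
    from v_0, hence nu is the restriction of an eigenmeasure.  The remaining
    bijectivity claims follow by composing isomorphisms. *)

(** * Free reduction of edge sequences *)

Section FreeReduction.
Set Implicit Arguments.
Unset Strict Implicit.
Unset Printing Implicit Defensive.
Variable V : finType.
Implicit Types (e : V * V) (s t x y g : seq (V * V)).

Definition nonbt e e' := e' != ebar e.
Definition reduced s := sorted nonbt s.
(** The inverse of a path in the fundamental groupoid. *)
Definition pinv s := rev (map (@ebar V) s).

Lemma ebarK : involutive (@ebar V). Proof. by case. Qed.

Lemma nonbt_sym e e' : nonbt e e' = nonbt (ebar e') (ebar e).
Proof. by rewrite /nonbt ebarK; congr negb; apply/eqP/eqP => ->; rewrite ?ebarK. Qed.

Lemma pinvK : involutive pinv.
Proof.
by move=> s; rewrite /pinv map_rev revK -map_comp map_id_in // => e _; exact: ebarK.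
Qed.

Lemma pinv_cons e s : pinv (e :: s) = rcons (pinv s) (ebar e).
Proof. by rewrite /pinv /= rev_cons. Qed.

Lemma size_pinv s : size (pinv s) = size s.
Proof. by rewrite /pinv size_rev size_map. Qed.

Lemma reduced_cons e t : reduced (e :: t) -> reduced t.
Proof. exact: path_sorted. Qed.

Lemma reduced_cat s t : reduced (s ++ t) -> reduced s /\ reduced t.
Proof. by move=> h; split; [exact: (cat_sorted2 h).1|exact: (cat_sorted2 h).2]. Qed.

Lemma reduced_rcons s e : reduced (rcons s e) -> reduced s.
Proof. by rewrite -cats1 => /reduced_cat[]. Qed.

Lemma reduced_pinv s : reduced (pinv s) = reduced s.
Proof.
rewrite /reduced /pinv rev_sorted sorted_map.
by apply: eq_sorted => e e' /=; rewrite -nonbt_sym.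
Qed.

Lemma reduced_redc e t : reduced t -> reduced (redc e t).
Proof.
case: t => //= e' t; case: eqP => [_|/eqP ne] /=; last by move=> ->; rewrite /nonbt ne.
exact: path_sorted.
Qed.

Lemma reduced_red s : reduced (red s).
Proof. by elim: s => //= e s IH; exact: reduced_redc. Qed.

Lemma redc_id e t : reduced (e :: t) -> redc e t = e :: t.
Proof. by case: t => //= e' t /andP[/negPf ->]. Qed.

Lemma red_id s : reduced s -> red s = s.
Proof.
elim: s => //= e s IH h; rewrite IH; last exact: path_sorted h.
exact: redc_id.
Qed.

(** Each [redc e] thus permutes the reduced sequences, with inverse [redc (ebar e)]. Words act on
    reduced sequences through it, and the compatibility of [red] with concatenation follows without
    a confluence argument. *)
Lemma redcK e t : reduced t -> redc (ebar e) (redc e t) = t.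
Proof.
case: t => [|e' t] /=; first by rewrite ebarK eqxx.
case: eqP => [-> h|_ _] /=; last by rewrite ebarK eqxx.
by rewrite redc_id.
Qed.

Lemma red_cat s t : red (s ++ t) = foldr (@redc V) (red t) s.
Proof. by rewrite /red foldr_cat. Qed.

Lemma red_catr s t : red (s ++ red t) = red (s ++ t).
Proof. by rewrite !red_cat (red_id (reduced_red t)). Qed.

Lemma red_catl s t : red (red s ++ t) = red (s ++ t).
Proof.
elim: s => //= e s IH; rewrite -IH.
case: (red s) => //= e' u; case: eqP => [->|_] //.
by rewrite -[X in redc X](ebarK e) redcK // reduced_red.
Qed.

Lemma red_pinvl s t : red (pinv s ++ s ++ t) = red t.
Proof.
elim: s t => //= e s IH t.
by rewrite pinv_cons cat_rcons red_cat /= redcK ?reduced_red // -red_cat IH.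
Qed.

Lemma red_actP g x y : reduced x -> red (g ++ x) = y -> red (pinv g ++ y) = x.
Proof. by move=> rx <-; rewrite red_catr red_pinvl red_id. Qed.

Lemma reduced_cat_mid x e t : reduced (rcons x e) -> reduced (e :: t) ->
  reduced (x ++ e :: t).
Proof.
case: x => //= a x; rewrite rcons_path cat_path /= => /andP[-> ->] /=.
by [].
Qed.

(** Each letter of [g] cancels at most one letter of [y], so all that follows the first [size g]
    letters of [y] is kept. *)
Lemma red_cat_drop g y : reduced y ->
  exists u, red (g ++ y) = u ++ drop (size g) y.
Proof.
move=> ry; elim: g => [|e g [u E]] /=; first by exists [::]; rewrite drop0 red_id.
rewrite E -add1n -drop_drop.
case: u E => [|a u] E /=.
  case: (drop _ _) => [|a t] /=; first by exists [:: e].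
  case: eqP => _; rewrite drop0; [by exists [::]|by exists [:: e; a]].
rewrite -{1 2}(cat_take_drop 1 (drop (size g) y)) catA.
by case: eqP => _; [eexists; reflexivity|exists (e :: a :: u ++ take 1 (drop (size g) y))].
Qed.

(** By the strict inequality at least one letter of [y] survives, and it shields [t] from
    cancellation. This makes translates of infinite rays computable from finite prefixes. *)
Lemma red_cat_stable g y t : reduced (y ++ t) -> (size g < size y)%N ->
  red (g ++ y ++ t) = red (g ++ y) ++ t.
Proof.
move=> ryt lt; have [ry _] := reduced_cat ryt.
rewrite catA -red_catl; have [u E] := red_cat_drop g ry.
rewrite E red_id //; have := reduced_red (g ++ y); rewrite E.
have {ryt}: reduced (drop (size g) y ++ t).
  by have := @drop_sorted _ nonbt (size g) _ ryt; rewrite drop_cat lt.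
have: (0 < size (drop (size g) y))%N by rewrite size_drop subn_gt0.
case: (drop _ _) => // a s _; rewrite -catA /= /reduced.
case: u {E} => [|b u] /=; first by [].
by rewrite !cat_path /= !cat_path => ->; case/and3P => -> -> _.
Qed.

Lemma size_red_cat g y : reduced y -> (size y - size g <= size (red (g ++ y)))%N.
Proof. by move=> /(red_cat_drop g)[u ->]; rewrite size_cat size_drop leq_addl. Qed.

(** Exactly the common prefix cancels, so the reduced form of g^-1 y has length [dT g y]. *)
Lemma red_pinv_lcp g y : reduced g -> reduced y ->
  (size (red (pinv g ++ y)) + 2 * lcp g y)%N = (size g + size y)%N.
Proof.
elim: g y => [|a g IH] y rg ry; first by rewrite /= red_id // muln0 addn0.
rewrite pinv_cons cat_rcons /=; case: y ry => [|b y] ry.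
  by rewrite cats1 -pinv_cons red_id ?reduced_pinv // size_pinv /= muln0.
case: eqP => [<-|/eqP ne].
  have ry' := reduced_cons ry.
  have -> : red (pinv g ++ ebar a :: a :: y) = red (pinv g ++ y).
    by rewrite !red_cat -[red (_ :: _)]/(redc _ (redc a (red y))) redcK ?reduced_red.
  by have := IH _ (reduced_cons rg) ry'; rewrite /=; lia.
rewrite red_id ?size_cat /= ?size_pinv ?muln0; first by lia.
apply: reduced_cat_mid; first by rewrite -pinv_cons reduced_pinv.
by apply/andP; split; [rewrite /nonbt ebarK eq_sym|exact: ry].
Qed.

Lemma lcp_take g y n : (size g <= n)%N -> lcp g (take n y) = lcp g y.
Proof.
elim: g y n => [|a g IH] [|b y] [|n] //= h.
by case: eqP => // _; rewrite IH.
Qed.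

Lemma lcp_le x y : (lcp x y <= size x)%N.
Proof. by elim: x y => [|a x IH] [|b y] //=; case: eqP => //= _; exact: IH. Qed.

(** For words of equal length the last letters can contribute only if everything before them
    agrees. *)
Lemma lcp_rcons x y e e' : size x = size y -> lcp (rcons x e) (rcons y e') =
  if rcons x e == rcons y e' then (size x).+1 else lcp x y.
Proof.
elim: x y => [|a x IH] [|b y] //= => [_|[/IH ->]].
  by rewrite eqseq_cons andbT; case: eqP.
by rewrite eqseq_cons; case: eqP => //= _; case: ifP.
Qed.
End FreeReduction.

(** * The universal cover *)

Section Tree.
Set Implicit Arguments.
Unset Strict Implicit.
Unset Printing Implicit Defensive.
Variables (V : finType) (adj : rel V) (v0 : V).
Hypothesis adj_sym : symmetric adj.
Implicit Types (e : V * V) (s t x y g : seq (V * V)) (u v w : V).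
Local Notation tvert := (tvert adj v0).
Local Notation codeB := (codeB adj v0).
Local Notation pr := (pr v0).

(** Backtracking is allowed and both endpoints are recorded, so that concatenation, inversion and
    free reduction all stay within the class. *)
Fixpoint epath u s v : bool :=
  if s is e :: s' then [&& isE adj e, e.1 == u & epath e.2 s' v] else u == v.

Lemma epath_cat u s t v w : epath u s v -> epath v t w -> epath u (s ++ t) w.
Proof.
by elim: s u => [u /eqP -> //|e s IH u] /= /and3P[-> -> h] /(IH _ h) ->.
Qed.

Lemma isE_ebar e : isE adj (ebar e) = isE adj e.
Proof. by rewrite /isE adj_sym. Qed.

Lemma epath_pinv u s v : epath u s v -> epath v (pinv s) u.
Proof.
elim: s u => [u|e s IH u] /=; first by rewrite eq_sym.
case/and3P=> h /eqP <- /IH p; rewrite pinv_cons -cats1.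
by apply: epath_cat p _; rewrite /= isE_ebar h !eqxx.
Qed.

Lemma epath_red u s v : epath u s v -> epath u (red s) v.
Proof.
elim: s u => //= e s IH u /and3P[he /eqP <- /IH].
case: (red s) => [|a t] /=; first by rewrite he eqxx.
case: (a =P ebar e) => [-> /and3P[_ _]|_ /= ->] //; by rewrite he eqxx.
Qed.

Lemma epath_pr s v : epath v0 s v -> pr s = v.
Proof.
have H e u : epath u (e :: s) v -> (last e s).2 = v.
  elim: s e u => [|a s IH] e u /= /and3P[_ _]; first by move/eqP.
  exact: IH.
case: s H => [|e s] H /=; first by move/eqP.
elim: s e v0 {H} => [|a s IH] e u /= /and3P[_ _]; first by move/eqP.
exact: IH.
Qed.

(** Separating non-backtracking from incidence is what identifies the tree vertices with the reduced
    walks from [v0]. *)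
Lemma path_turnE e x : isE adj e ->
  path (turn adj) e x = path (@nonbt V) e x && epath e.2 x (last e x).2.
Proof.
elim: x e => [|a x IH] e he /=; first by rewrite eqxx.
rewrite /turn he /=; have [ha|] := boolP (isE adj a); last by rewrite !andbF.
rewrite IH // [e.2 == _]eq_sym /nonbt /=.
by case: (a.1 == _); rewrite ?andbF /= ?andbA.
Qed.

Lemma tvertE x : tvert x = reduced x && epath v0 x (pr x).
Proof.
case: x => [|e x]; first by rewrite /= eqxx.
rewrite /Defs.tvert /= /reduced /=; have [he|] := boolP (isE adj e); last by rewrite !andbF.
by rewrite path_turnE // -andbA [_ && (e.1 == _)]andbC /= andbCA.
Qed.

Lemma tvert_reduced x : tvert x -> reduced x.
Proof. by rewrite tvertE => /andP[]. Qed.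

Lemma tvert_epath x : tvert x -> epath v0 x (pr x).
Proof. by rewrite tvertE => /andP[]. Qed.

Lemma epath_tvert x v : reduced x -> epath v0 x v -> tvert x /\ pr x = v.
Proof. by move=> rx p; rewrite tvertE rx (epath_pr p). Qed.

Lemma codeB_tvert x : codeB x -> tvert x.
Proof. by rewrite /Defs.tvert => ->; rewrite orbT. Qed.

Lemma tvert_rcons x e : tvert (rcons x e) = codeB (rcons x e).
Proof. by case: x. Qed.

Lemma pr_rcons x e : pr (rcons x e) = e.2.
Proof. by case: x => //= a x; rewrite last_rcons. Qed.

Lemma codeB1 e : codeB [:: e] = isE adj e && (e.1 == v0).
Proof. by rewrite /= andbT. Qed.

Lemma code_rcons2 x e0 e :
  code adj (rcons (rcons x e0) e) = code adj (rcons x e0) && turn adj e0 e.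
Proof.
by case: x => [|a x] /=; rewrite ?rcons_path ?last_rcons ?andbT ?andbA.
Qed.

Lemma codeB_rcons2 x e0 e :
  codeB (rcons (rcons x e0) e) = codeB (rcons x e0) && turn adj e0 e.
Proof.
have := code_rcons2 x e0 e; case: x => [|a x] /= ->; by rewrite andbAC.
Qed.

Lemma codeB_code x : codeB x -> code adj x.
Proof. by case: x => //= e x /andP[]. Qed.

Lemma code_isE x e : code adj (rcons x e) -> isE adj e.
Proof.
case/lastP: x => [|x e0]; first by rewrite /= andbT.
by rewrite code_rcons2 => /andP[_ /and4P[]].
Qed.

Lemma codeB_isE x e : codeB (rcons x e) -> isE adj e.
Proof. by move/codeB_code/code_isE. Qed.

Lemma codeB_rcons x e : codeB (rcons x e) -> tvert x /\ pr x = e.1.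
Proof.
case/lastP: x => [|x e0]; first by rewrite codeB1 => /andP[_ /eqP ->].
rewrite codeB_rcons2 pr_rcons tvert_rcons => /andP[-> /and4P[_ _ /eqP -> _]].
by [].
Qed.

Lemma isLoop_epath g : isLoop adj v0 g -> epath v0 g v0.
Proof. by case/andP=> /tvert_epath p /eqP {2}<-. Qed.

Lemma actT_tvert g x : isLoop adj v0 g -> tvert x ->
  tvert (actT g x) /\ pr (actT g x) = pr x.
Proof.
move=> /isLoop_epath pg /tvert_epath px.
by apply: epath_tvert; [exact: reduced_red|apply/epath_red/(epath_cat pg px)].
Qed.

Lemma loop_of_epath s : epath v0 s v0 -> isLoop adj v0 (red s).
Proof.
move=> p; rewrite /isLoop.
by have [-> ->] := epath_tvert (reduced_red s) (epath_red p); rewrite eqxx.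
Qed.

(** The loop that runs along [y] and back along [x] does it: the deck group is transitive on the
    fibres of [pr]. *)
Lemma actT_transitive x y : tvert x -> tvert y -> pr x = pr y ->
  exists2 g, isLoop adj v0 g & actT g x = y.
Proof.
move=> tx ty E; exists (red (y ++ pinv x)).
  apply/loop_of_epath/(epath_cat (tvert_epath ty)); rewrite -E.
  exact/epath_pinv/tvert_epath.
rewrite /actT red_catl -catA -red_catr -{2}[x]cats0 red_pinvl cats0.
by rewrite red_id // tvert_reduced.
Qed.

Lemma pr_surj (G_conn : forall u v, connect adj u v) v : exists2 x, tvert x & pr x = v.
Proof.
have [s p] : exists s, epath v0 s v.
  case/connectP: (G_conn v0 v) => p; elim: p v0 => [|w p IH] u /=.
    by move=> _ ->; exists [::]; rewrite /= eqxx.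
  case/andP=> uw /IH{}IH /IH[s ps]; exists ((u, w) :: s).
  by rewrite /= /isE /= uw eqxx.
by have [tx px] := epath_tvert (reduced_red s) (epath_red p); exists (red s).
Qed.

(** [pr] is a local isomorphism: the neighbours of [x] in the tree correspond one to one to those of
    [pr x] in the graph. *)
Lemma SigT_pr f x : tvert x ->
  SigT adj v0 (fun y => f (pr y)) x = Sigop adj f (pr x).
Proof.
case/lastP: x => [_|x e0].
  rewrite /SigT addr0 /Sigop /=.
  rewrite (reindex_onto (fun w => (v0, w)) snd) /=; last first.
    by case=> a b; rewrite /Defs.tvert /= andbT => /andP[_ /eqP <-].
  by apply: eq_bigl => w; rewrite /Defs.tvert /= /isE /= !eqxx !andbT.
rewrite tvert_rcons => cx; have [tx px] := codeB_rcons cx.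
have he : isE adj e0 by exact: codeB_isE cx.
(* The parent lies over the tail of the last edge [e0]; the children account for all other
   neighbours. *)
rewrite /SigT pr_rcons /Sigop [RHS](bigD1 e0.1) /=; last first.
  by have := he; rewrite /isE adj_sym.
rewrite addrC -px; congr (_ + _); last first.
  by case: (x) => [|a y] //; rewrite rcons_cons belast_rcons.
rewrite (reindex_onto (fun w => (e0.2, w)) snd) /=; last first.
  by case=> a b; rewrite tvert_rcons codeB_rcons2 => /andP[_ /and4P[_ _ /eqP /= -> _]].
apply: eq_big => [w|w _]; last by rewrite pr_rcons.
rewrite tvert_rcons codeB_rcons2 cx /turn he /isE /= !eqxx !andbT /=.
by rewrite px /ebar xpair_eqE eqxx.
Qed.

(** Counting neighbours is the case f = 1 of [SigT_pr]. *)
Lemma degT_pr x : tvert x -> (degT adj v0 x)%:R = (deg adj (pr x))%:R :> CC.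
Proof.
move=> tx; have := SigT_pr (fun=> 1) tx; rewrite /SigT /Sigop !sumr_const.
by rewrite /degT natrD /deg => <-; congr (_ + _); case: (x).
Qed.

End Tree.

(** * Integration of locally constant functions *)

(* The path space [P] and the boundary share one integration theory: [K] selects
   the admissible cylinders, [ray] the points, and [ext] picks a point in each
   admissible cylinder. *)
Section Cylinders.
Set Implicit Arguments.
Unset Strict Implicit.
Unset Printing Implicit Defensive.
Variables (E : finType) (K : pred (seq E)) (ray : (nat -> E) -> Prop).
Variable ext : seq E -> nat -> E.
Hypothesis K0 : K [::] = false.
Hypothesis K_rcons : forall c e, (0 < size c)%N -> K (rcons c e) -> K c.
Hypothesis K_ray : forall p m, ray p -> (0 < m)%N -> K (mkseq p m).
Hypothesis ray_ext : forall c, K c -> ray (ext c).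
Hypothesis mkseq_ext : forall c, K c -> mkseq (ext c) (size c) = c.
Implicit Types (c : seq E) (w : seq E -> CC) (f : (nat -> E) -> CC) (m n : nat).

Definition cyl c p := ray p /\ mkseq p (size c) = c.
Definition loc (T : Type) m (f : (nat -> E) -> T) :=
  forall p p', ray p -> ray p' -> mkseq p m = mkseq p' m -> f p = f p'.
Definition csum m (F : seq E -> CC) : CC := \sum_(t : m.-tuple E | K t) F t.
Definition wadd w := forall c, K c -> w c = \sum_(e | K (rcons c e)) w (rcons c e).
(** A Riemann sum at depth [m] with sample points [ext c]; for locally constant [f] and additive [w]
    it is the integral. *)
Definition isum m f w := csum m (fun c => f (ext c) * w c).

Lemma take_mkseq (p : nat -> E) m n : (m <= n)%N -> take m (mkseq p n) = mkseq p m.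
Proof. by move=> mn; rewrite /mkseq -map_take take_iota (minn_idPl mn). Qed.

Lemma mkseq_le (p p' : nat -> E) m n : (m <= n)%N -> mkseq p n = mkseq p' n ->
  mkseq p m = mkseq p' m.
Proof. by move=> mn h; rewrite -(take_mkseq p mn) h take_mkseq. Qed.

Lemma loc_le T m n (f : (nat -> E) -> T) : (m <= n)%N -> loc m f -> loc n f.
Proof. by move=> mn h p p' rp rp' /(mkseq_le mn); exact: h. Qed.

Lemma loc_ext T c (f : (nat -> E) -> T) p : K c -> loc (size c) f -> cyl c p ->
  f p = f (ext c).
Proof. by move=> Kc h [rp mp]; apply: h => //; [exact: ray_ext|rewrite mkseq_ext]. Qed.

Lemma eq_csum m F G : (forall c, K c -> size c = m -> F c = G c) -> csum m F = csum m G.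
Proof. by move=> h; apply: eq_bigr => t Kt; rewrite h // size_tuple. Qed.

Lemma csum1 F : csum 1 F = \sum_(e | K [:: e]) F [:: e].
Proof.
rewrite /csum (reindex_onto (fun e => [tuple e]) (fun t => thead t)) /=; last first.
  by move=> t _; rewrite [RHS]tuple_eta; apply/val_inj; case/tupleP: t => a t; rewrite /= tuple0.
by apply: eq_bigl => e; rewrite theadE eqxx andbT.
Qed.

Definition unrcons m (t : m.+1.-tuple E) : m.-tuple E * E :=
  ([tuple of belast (thead t) (behead t)], last (thead t) (behead t)).

Lemma unrconsK m (t : m.-tuple E) e : unrcons [tuple of rcons t e] = (t, e).
Proof.
rewrite /unrcons /thead (tnth_nth e) /=; congr pair; last first.
  by case: (t) => -[|a s] /= _ //; rewrite last_rcons.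
by apply/val_inj; case: (t) => -[|a s] /= _ //; rewrite belast_rcons.
Qed.

Lemma csumS m F : (0 < m)%N ->
  csum m.+1 F = csum m (fun c => \sum_(e | K (rcons c e)) F (rcons c e)).
Proof.
move=> m0; rewrite /csum pair_big_dep /=.
rewrite (reindex_onto (fun u : m.-tuple E * E => [tuple of rcons u.1 u.2]) (@unrcons m)) /=.
  apply: eq_big => [[t e]|//] /=; rewrite unrconsK eqxx andbT.
  case: (boolP (K (rcons _ _))) => //= hK; first by rewrite (K_rcons _ hK) // size_tuple.
  by rewrite andbF.
move=> t _; case/tupleP: t => a t; apply/val_inj.
by rewrite /= /thead (tnth_nth a) /= -lastI.
Qed.

(** Splitting each cylinder into its children changes neither the value of [f] on it nor, by
    additivity, the total weight. *)
Lemma isumS m f w : (0 < m)%N -> loc m f -> wadd w -> isum m.+1 f w = isum m f w.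
Proof.
move=> m0 lf aw; rewrite /isum csumS //; apply: eq_csum => c Kc sc.
rewrite (aw _ Kc) mulr_sumr; apply: eq_bigr => e Ke; congr (_ * _).
apply: loc_ext => //; first by rewrite sc.
split; first exact: ray_ext.
have := mkseq_ext Ke; rewrite size_rcons mkseqS => /(congr1 (take (size c))).
by rewrite -!cats1 !take_size_cat // size_mkseq.
Qed.

Lemma isum_le m n f w : (0 < m <= n)%N -> loc m f -> wadd w -> isum n f w = isum m f w.
Proof.
case/andP=> m0 mn lf aw; elim: n mn => [|n IH]; first by rewrite leqn0 => /eqP ->.
rewrite leq_eqVlt => /orP[/eqP -> //|]; rewrite ltnS => mn.
by rewrite isumS ?IH //; [exact: leq_trans mn|exact: loc_le lf].
Qed.

(** Both sums equal the one at the common refinement [maxn m n]. *)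
Lemma isum_indep m n f w : (0 < m)%N -> (0 < n)%N -> loc m f -> loc n f -> wadd w ->
  isum n f w = isum m f w.
Proof.
move=> m0 n0 lm ln aw; rewrite -(isum_le (n := maxn m n) _ ln) ?n0 ?leq_maxr //.
by rewrite (isum_le (n := maxn m n) _ lm) // m0 leq_maxl.
Qed.

(** [cconst], [cval] and [cdepth] have the shape of the constancy, value and depth used by both
    [pairP] and [bint], which therefore unfold to them. *)
Definition cconst m f :=
  forall c, K c -> size c = m -> exists a, forall p, cyl c p -> f p = a.
Definition cval f c : CC := xget 0 (fun a => forall p, cyl c p -> f p = a).
Definition cdepth f := xget 1%N (fun m => (0 < m)%N /\ cconst m f).

Lemma cconst_loc m f : (0 < m)%N -> cconst m f <-> loc m f.
Proof.
move=> m0; split=> [h p p' rp rp' E'|h c Kc sc].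
  have [a ha] := h _ (K_ray rp m0) (size_mkseq _ _).
  by rewrite (ha p) ?(ha p') //; split; rewrite // size_mkseq ?E'.
by exists (f (ext c)) => p; apply: loc_ext; rewrite ?sc.
Qed.

Lemma cval_ext c f : K c -> loc (size c) f -> cval f c = f (ext c).
Proof.
move=> Kc lf; rewrite /cval; case: xgetP => [a _ h|/(_ (f (ext c)))[]].
  by rewrite h //; split; [exact: ray_ext|exact: mkseq_ext].
by move=> p; exact: loc_ext.
Qed.

Lemma csum_cval m f w : loc m f -> csum m (fun c => cval f c * w c) = isum m f w.
Proof. by move=> lf; apply: eq_csum => c Kc sc; rewrite cval_ext ?sc. Qed.

(** The depth picked by [xget] is an unspecified one at which [f] is constant; any convenient [m]
    can replace it. *)
Lemma csum_cdepth m f w : (0 < m)%N -> loc m f -> wadd w ->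
  csum (cdepth f) (fun c => cval f c * w c) = isum m f w.
Proof.
move=> m0 lf aw; rewrite /cdepth; case: xgetP => [d _ [d0 cd]|/(_ m)[]].
  have ld : loc d f by apply/cconst_loc.
  by rewrite csum_cval //; exact: isum_indep.
by split=> //; apply/cconst_loc.
Qed.

Lemma csum_pick c F : K c ->
  csum (size c) (fun c' => if c' == c then F c' else 0) = F c.
Proof.
move=> Kc; rewrite /csum (bigD1 (in_tuple c)) //= eqxx big1 ?addr0 // => t /andP[_ ne].
by case: eqP => // E'; case/eqP: ne; apply/val_inj.
Qed.

Lemma isum_linl m (a b : CC) f1 f2 w :
  isum m (fun p => a * f1 p + b * f2 p) w = a * isum m f1 w + b * isum m f2 w.
Proof.
rewrite /isum /csum !mulr_sumr -big_split; apply: eq_bigr => t _ /=.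
by rewrite mulrDl !mulrA.
Qed.

End Cylinders.

(** * Extending finite paths to infinite ones *)

Section Extension.
Set Implicit Arguments.
Unset Strict Implicit.
Unset Printing Implicit Defensive.
Variables (V : finType) (adj : rel V) (v0 : V).
Hypothesis adj_sym : symmetric adj.
Hypothesis deg_ge2 : forall v : V, (2 <= deg adj v)%N.
Implicit Types (e : V * V) (c : seq (V * V)).

Definition nexte e := odflt e [pick e' | turn adj e e'].

(** Without a continuation, the tail of [e] would be the only neighbour of its head, against degree
    at least two. *)
Lemma turn_nexte e : isE adj e -> turn adj e (nexte e).
Proof.
move=> he; rewrite /nexte; case: pickP => //= h.
have := deg_ge2 e.2; rewrite /deg leqNgt => /negP[]; rewrite ltnS.
rewrite -(card1 e.1); apply/subset_leq_card/fintype.subsetP => w; rewrite !inE => aw.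
have := h (e.2, w); rewrite /turn he /isE aw eqxx /= => /negbFE.
by rewrite /ebar xpair_eqE eqxx.
Qed.

(** A canonical point of the district of [c]: after [c] the path goes on by iterating [nexte]. The
    pair [(v0, v0)] is only a default value. *)
Definition extr c (n : nat) : V * V :=
  if (n < size c)%N then nth (v0, v0) c n
  else iter (n - size c).+1 nexte (last (v0, v0) c).

Lemma mkseq_extr c : mkseq (extr c) (size c) = c.
Proof.
rewrite -[RHS](mkseq_nth (v0, v0)); apply/eq_in_map => i.
by rewrite mem_iota /extr => /= ->.
Qed.

Lemma inP_turn (p : nat -> V * V) : isE adj (p 0%N) ->
  (forall i, isE adj (p i) -> turn adj (p i) (p i.+1)) -> inP adj p.
Proof.
by move=> p0 h i; apply: (h); elim: i => // i /h /and4P[].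
Qed.

Lemma extr_inP c : code adj c -> inP adj (extr c).
Proof.
case: c => // e c /= /andP[he pc]; apply: inP_turn => // i.
rewrite /extr /=; case: (ltngtP i (size c)) => [lt|gt|->].
- by rewrite !ltnS (ltnW lt) lt => _; have /(pathP (v0, v0)) := pc; apply.
- rewrite !ltnS leqNgt gt /= leqNgt (ltn_trans gt) //=.
  have -> : (i.+1 - (size c).+1 = (i - (size c).+1).+1)%N by lia.
  exact: turn_nexte.
- rewrite ltnS leqnn ltnn subnn /=.
  have -> : nth (v0, v0) (e :: c) (size c) = last e c by rewrite (last_nth (v0, v0)).
  exact: turn_nexte.
Qed.

Lemma inP_code (p : nat -> V * V) m : inP adj p -> (0 < m)%N -> code adj (mkseq p m).
Proof.
move=> ip; case: m => // m _; elim: m => [|m IH].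
  by rewrite /= andbT; case/and4P: (ip 0%N).
by rewrite 2!mkseqS code_rcons2 -mkseqS IH ip.
Qed.

Lemma code_rcons c e : (0 < size c)%N -> code adj (rcons c e) -> code adj c.
Proof. by case/lastP: c => // c e0 _; rewrite code_rcons2 => /andP[]. Qed.

Lemma codeB_rconsl c e : (0 < size c)%N -> codeB adj v0 (rcons c e) -> codeB adj v0 c.
Proof. by case/lastP: c => // c e0 _; rewrite codeB_rcons2 => /andP[]. Qed.

Lemma ray_codeB (p : nat -> V * V) m : ray adj v0 p -> (0 < m)%N -> codeB adj v0 (mkseq p m).
Proof.
case=> ip p0 m0; have := inP_code ip m0; case: m m0 => // m _ /= ->.
by rewrite p0 eqxx.
Qed.

Lemma extr_ray c : codeB adj v0 c -> ray adj v0 (extr c).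
Proof.
move=> cc; split; first exact: (extr_inP (codeB_code cc)).
by case: c cc => [//|e c /andP[_ /eqP]].
Qed.

End Extension.

(** * Eigenfunctions on the graph *)

Section Eigen.
Set Implicit Arguments.
Unset Strict Implicit.
Unset Printing Implicit Defensive.
Variables (V : finType) (adj : rel V) (v0 : V) (z : CC).
Hypothesis adj_sym : symmetric adj.
Hypothesis deg_ge2 : forall v : V, (2 <= deg adj v)%N.
Hypotheses (z0 : z != 0) (z1 : z != 1) (zN1 : z != -1).
Implicit Types (e : V * V) (c x y : seq (V * V)) (u v w : V) (mu : seq (V * V) -> CC).
Local Notation ext := (extr adj v0).

Lemma sqrz1 : z ^+ 2 - 1 != 0.
Proof. by rewrite subr_eq0 sqrf_eq1 negb_or z1. Qed.

Lemma mkseq_consE (T : Type) (p : nat -> T) n :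
  mkseq p n.+1 = p 0%N :: mkseq (fun i => p i.+1) n.
Proof. by rewrite /mkseq /= (iotaDl 1 0) -map_comp. Qed.

(** Only the summand [e0 = e] can contribute. *)
Lemma Top_ind e c (p : nat -> V * V) : Top adj (ind (e :: c)) p =
  (turn adj e (p 0%N) && (mkseq p (size c) == c))%:R.
Proof.
rewrite /Top /ind /= -big_mkcondr /=.
under eq_bigl => e0 do rewrite mkseq_consE eqseq_cons /=.
have [_|ne] := boolP (mkseq p (size c) == c); last first.
  by rewrite big_pred0 ?andbF // => e0; rewrite !andbF.
rewrite andbT; under eq_bigl => e0 do rewrite andbT andbC.
have [te|nte] := boolP (turn adj e (p 0%N)).
  by rewrite (big_pred1 e) // => e0 /=; case: eqP => //= ->.
by rewrite big_pred0 // => e0; case: eqP => //= ->; exact: negbTE.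
Qed.

Lemma FAP_wadd mu : FAP adj mu -> wadd (code adj) mu.
Proof.
case=> _ h c; case/lastP: c => // c e0 cc; rewrite h //.
by apply: eq_bigl => e; rewrite code_rcons2 cc.
Qed.

Lemma pairP_isum mu f m : FAP adj mu -> (0 < m)%N -> loc (inP adj) m f ->
  pairP adj f mu = isum (code adj) ext m f mu.
Proof.
move=> /FAP_wadd aw m0 lf.
apply: (@csum_cdepth _ (code adj) (inP adj)) => //.
- exact: code_rcons.
- exact: inP_code.
- exact: extr_inP.
- by move=> c _; exact: mkseq_extr.
Qed.

(** For nonempty [c] the turn out of [e] is already prescribed by the code, so the transfer operator
    sends the indicator of [e :: c] to that of [c]. *)
Lemma Tdual_cons mu e c : FAP adj mu -> c != [::] -> code adj (e :: c) ->
  Tdual adj mu (e :: c) = mu c.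
Proof.
move=> hmu c0 cc; have m0 : (0 < size c)%N by case: (c) c0.
have kc : code adj c.
  by case: c c0 cc {m0} => //= a c _ /and3P[_ /and4P[_ -> _ _] ->].
rewrite /Tdual (pairP_isum hmu m0); last first.
  move=> p p' _ _ E; rewrite !Top_ind E.
  by case: (size c) m0 E => // m _; rewrite !mkseq_consE => -[->].
rewrite /isum -(csum_pick mu kc); apply: eq_csum => c' kc' sc.
rewrite Top_ind -sc mkseq_extr; case: eqP => [->|_]; last by rewrite andbF mul0r.
rewrite andbT; have -> : turn adj e (ext c 0%N).
  by case: c cc c0 {m0 kc sc} => //= a c /and3P[_ ->].
by rewrite mul1r.
Qed.

Lemma Tdual_one mu e : FAP adj mu -> isE adj e ->
  Tdual adj mu [:: e] = \sum_(e' | turn adj e e') mu [:: e'].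
Proof.
move=> hmu he; rewrite /Tdual (pairP_isum hmu (m := 1)) //; last first.
  by move=> p p' _ _; rewrite !Top_ind /= => -[->].
rewrite /isum csum1 big_mkcond [RHS]big_mkcond; apply: eq_bigr => e' _.
rewrite Top_ind (_ : ext [:: e'] 0%N = e') // andbT /turn he /= andbT.
case: (isE adj e') => //=; case: (_ && _); by rewrite ?mul1r ?mul0r.
Qed.

Lemma EigP_cons mu e c : EigP adj z mu -> c != [::] -> code adj (e :: c) ->
  mu c = z * mu (e :: c).
Proof. by case=> hmu h c0 cc; rewrite -h // Tdual_cons. Qed.

Lemma EigP_one mu e : EigP adj z mu -> isE adj e ->
  \sum_(e' | turn adj e e') mu [:: e'] = z * mu [:: e].
Proof. by case=> hmu h he; rewrite -h ?Tdual_one //= he. Qed.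

(** Each first edge stripped off costs a factor z. Hence an eigenmeasure is determined by its values
    on single edges. *)
Lemma EigP_rcons mu c e : EigP adj z mu -> code adj (rcons c e) ->
  mu [:: e] = z ^+ size c * mu (rcons c e).
Proof.
move=> hmu; elim: c => [|a c IH] cc; first by rewrite mul1r.
have kc : code adj (rcons c e).
  move: cc; rewrite rcons_cons; case: (rcons c e) (size_rcons c e) => //= b s _.
  by case/and3P=> _ /and4P[_ -> _ _] ->.
rewrite IH // rcons_cons in cc *; rewrite (EigP_cons hmu _ cc); last by case: (c).
by rewrite exprSr mulrA.
Qed.

(* The reversal undoes the one in [fmu]. *)
Definition mu_of (g : V * V -> CC) c : CC :=
  if code adj c then (z ^+ (size c).-1)^-1 * g (ebar (last (v0, v0) c)) else 0.

Lemma turn_ebar e e' : turn adj (ebar e) (ebar e') = turn adj e' e.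
Proof.
rewrite /turn !(isE_ebar adj_sym) ebarK [RHS]andbCA eq_sym; congr [&& _, _, _ & _].
by apply/negP/negP => ne /eqP E; apply: ne; rewrite E ?ebarK.
Qed.

Lemma sum_ebar (P : pred (V * V)) (F : V * V -> CC) :
  \sum_(e | P e) F (ebar e) = \sum_(e | P (ebar e)) F e.
Proof.
rewrite [RHS](reindex_inj (can_inj (@ebarK V))) /=.
by apply: eq_bigl => e; rewrite ebarK.
Qed.

(** Additivity and the eigenvalue equation on one-edge codes both amount to S g = z g after
    reversing orientation; on longer codes the eigenvalue equation is built into the power of z. *)
Lemma mu_of_EigP g : EqS adj z g -> EigP adj z (mu_of g) /\ fmu (mu_of g) = g.
Proof.
case=> g0 hg; have S e : isE adj e -> \sum_(e' | turn adj e e') g (ebar e') = z * g (ebar e).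
  move=> he; rewrite -hg ?isE_ebar // /Sop sum_ebar; apply: eq_bigl => e'.
  by rewrite -turn_ebar ebarK.
have F : FAP adj (mu_of g).
  split=> [c|c e0 cc]; first by rewrite /mu_of => /negPf ->.
  rewrite /mu_of cc size_rcons last_rcons /=.
  under eq_bigr => e te do rewrite code_rcons2 cc te /= !size_rcons last_rcons /=.
  by rewrite -mulr_sumr S ?(code_isE cc) // exprS invfM mulrACA mulVf // mul1r.
split; last first.
  apply/funext => e; rewrite /fmu /mu_of /= andbT isE_ebar // ebarK expr0 invr1 mul1r.
  by case: ifP => // /negbT /g0.
split=> // -[|e c] // cc; have he : isE adj e by case/andP: cc.
have [->|c0] := eqVneq c [::].
  rewrite Tdual_one // /mu_of /= he /= expr0 invr1 mul1r -S //.
  by apply: eq_bigr => e1 /and4P[_ -> _ _]; rewrite /= mul1r.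
rewrite Tdual_cons // /mu_of cc; case: c c0 cc => //= a c _.
case/and3P=> _ /and4P[_ -> _ _] -> /=.
by rewrite exprS invfM !mulrA divff // mul1r.
Qed.

Lemma fmu_EqS mu : EigP adj z mu -> EqS adj z (fmu mu).
Proof.
move=> hmu; split=> e he.
  by case: hmu => [[h _] _]; apply: h; rewrite /= andbT isE_ebar.
rewrite /fmu -EigP_one ?isE_ebar // /Sop (sum_ebar _ (fun e => mu [:: e])).
by apply: eq_bigl => e'; rewrite -turn_ebar ebarK.
Qed.

Lemma fmu_inj mu mu' : EigP adj z mu -> EigP adj z mu' -> fmu mu = fmu mu' -> mu = mu'.
Proof.
move=> h h' E; apply/funext => c.
have [cc|nc] := boolP (code adj c); last first.
  by case: h h' => [[-> // _] _] [[-> // _] _].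
case/lastP: c cc => // c e cc; apply: (mulfI (expf_neq0 (size c) z0)).
rewrite -!EigP_rcons //.
by have := congr1 (fun f => f (ebar e)) E; rewrite /fmu ebarK.
Qed.

Lemma lin_iso_fmu : lin_iso (EigP adj z) (EqS adj z) (@fmu V).
Proof.
split=> //; [exact: fmu_EqS|exact: fmu_inj|].
by move=> g /mu_of_EigP[h E]; exists (mu_of g).
Qed.

(** * From edge functions to vertex functions *)

Lemma IopE g v : Iop adj g v = \sum_(w | adj v w) g (w, v).
Proof.
rewrite /Iop (reindex_onto (fun w => (w, v)) fst) /=; last first.
  by case=> a b /andP[_ /eqP /= ->].
by apply: eq_bigl => w; rewrite /isE /= !eqxx !andbT adj_sym.
Qed.

(** The edges ending at the tail of [e] are those turning into [e], together with [ebar e]. *)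
Lemma Iop_Sop g e : isE adj e -> Iop adj g e.1 = Sop adj g e + g (ebar e).
Proof.
move=> he; rewrite /Iop (bigD1 (ebar e)) /=; last by rewrite isE_ebar // he eqxx.
rewrite addrC; congr (_ + _); apply: eq_bigl => e'.
rewrite /turn he /= -andbA; do 2 congr (_ && _).
by apply/negP/negP => ne /eqP E; apply: ne; rewrite E ?ebarK.
Qed.

Lemma Iop_eq g e : EqS adj z g -> isE adj e -> Iop adj g e.1 = z * g e + g (ebar e).
Proof. by case=> _ hg he; rewrite -hg // Iop_Sop. Qed.

Lemma qC_deg v : \sum_(w | adj v w) 1 = 1 + qC adj v.
Proof. by rewrite /qC addrC subrK sumr_const. Qed.

Lemma Iop_EqSig g : EqS adj z g -> EqSig adj z (Iop adj g).
Proof.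
move=> hg v; rewrite /Sigop /Rz.
(* Applying [Iop_eq] to (w, v) and to (v, w) and eliminating g(v, w) leaves only the edges entering
   [v], whose values sum to [Iop adj g v]. *)
have E w : adj v w -> Iop adj g w = z * g (w, v) + (Iop adj g v * 1 - g (w, v)) / z.
  move=> vw; have wv : isE adj (w, v) by rewrite /isE /= adj_sym.
  rewrite (Iop_eq hg wv) (@Iop_eq g (v, w) hg vw) /ebar /=.
  by field.
rewrite (eq_bigr _ E) big_split /= -mulr_sumr -mulr_suml sumrB -mulr_sumr qC_deg -IopE.
by field.
Qed.

(** The solution of z g(e) + g(ebar e) = f(iota e) and z g(ebar e) + g(e) = f(tau e), a linear
    system of determinant z^2 - 1. *)
Definition edge_of (f : V -> CC) e : CC :=
  if isE adj e then (z * f e.1 - f e.2) / (z ^+ 2 - 1) else 0.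

Lemma edge_of_Iop g : EqS adj z g -> edge_of (Iop adj g) = g.
Proof.
move=> hg; apply/funext => e; rewrite /edge_of; case: ifP => he; last first.
  by case: hg => -> //; rewrite he.
have he' : isE adj (ebar e) by rewrite isE_ebar.
rewrite (Iop_eq hg he) (Iop_eq hg he' : Iop adj g e.2 = _) ebarK.
apply: (mulIf sqrz1); rewrite divfK ?sqrz1 //; ring.
Qed.

Lemma Iop_edge_of f : EqSig adj z f -> Iop adj (edge_of f) = f.
Proof.
move=> hf; apply/funext => v; rewrite IopE.
have E w : adj v w -> edge_of f (w, v) = (z * f w - f v * 1) / (z ^+ 2 - 1).
  by move=> vw; rewrite /edge_of /isE /= adj_sym vw mulr1.
rewrite (eq_bigr _ E) -mulr_suml sumrB -!mulr_sumr qC_deg.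
rewrite -/(Sigop adj f v) hf /Rz; apply: (mulIf sqrz1); rewrite divfK ?sqrz1 //.
by field.
Qed.

Lemma edge_of_EqS f : EqSig adj z f -> EqS adj z (edge_of f).
Proof.
move=> hf; split=> e he; first by rewrite /edge_of (negbTE he).
have := Iop_Sop (edge_of f) he; rewrite Iop_edge_of // => /eqP.
rewrite -subr_eq => /eqP <-; rewrite /edge_of isE_ebar // he /=.
by field; exact: sqrz1.
Qed.

Lemma lin_iso_Iop : lin_iso (EqS adj z) (EqSig adj z) (Iop adj).
Proof.
split; first exact: Iop_EqSig.
- move=> a u v _ _; apply/funext => w; rewrite /Iop mulr_sumr -big_split.
  by [].
- by move=> u v hu hv E; rewrite -(edge_of_Iop hu) E edge_of_Iop.
- by move=> f hf; exists (edge_of f); [exact: edge_of_EqS|exact: Iop_edge_of].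
Qed.

(** The two equations at v differ by the factor 1 + q(v), the degree of v, which is nonzero. *)
Lemma EqSig_EqDel f : EqSig adj z f <-> EqDel adj z f.
Proof.
have q0 v : 1 + qC adj v != 0.
  rewrite /qC addrC subrK pnatr_eq0 -lt0n; exact: leq_trans (deg_ge2 v).
split=> h v; have := h v; rewrite /EqDel /Delop /Lz /Rz.
  by move=> ->; field; rewrite q0 z0.
move=> E; apply: (mulfI (invr_neq0 (q0 v))); rewrite E.
by field; rewrite q0 z0.
Qed.

(** * Lifting vertex functions to the universal cover *)

Section Lift.
Hypothesis G_conn : forall u v : V, connect adj u v.

Lemma EqSigT_lift f : EqSigT adj v0 z (liftpr adj v0 f) <-> EqSig adj z f.
Proof.
have E x : tvert adj v0 x -> (SigT adj v0 (liftpr adj v0 f) x = RzT adj v0 z (liftpr adj v0 f) x)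
   <-> Sigop adj f (pr v0 x) = Rz adj z f (pr v0 x).
  move=> tx; rewrite /RzT /Rz {2}/liftpr tx degT_pr // -(SigT_pr adj_sym f tx).
  (* The lift is 0 off the tree, where f composed with [pr] need not vanish; [SigT] at a tree vertex
     evaluates its argument at tree vertices only. *)
  suff -> : SigT adj v0 (liftpr adj v0 f) x = SigT adj v0 (fun y => f (pr v0 y)) x by [].
  rewrite /SigT; congr (_ + _); first by apply: eq_bigr => e te; rewrite /liftpr te.
  case/lastP: x tx => // x e; rewrite tvert_rcons => /codeB_rcons[tx _].
  by case: x tx => //= a x tx; rewrite belast_rcons /liftpr tx.
split=> [[_ h] v|h].
  by have [x tx <-] := pr_surj v0 G_conn v; apply/E => //; exact: h.
split=> x tx; last by apply/E => //; exact: h.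
by rewrite /liftpr (negbTE tx).
Qed.

Lemma GinvT_lift f : GinvT adj v0 (liftpr adj v0 f).
Proof.
by move=> g x hg tx; have [ty E] := actT_tvert hg tx; rewrite /liftpr tx ty E.
Qed.

Lemma lin_iso_lift : lin_iso (EqSig adj z)
  (fun F => EqSigT adj v0 z F /\ GinvT adj v0 F) (liftpr adj v0).
Proof.
split.
- by move=> f hf; split; [exact/EqSigT_lift|exact: GinvT_lift].
- move=> a f h _ _; apply/funext => x; rewrite /liftpr; case: ifP => //.
  by rewrite mulr0 addr0.
- move=> f h _ _ E; apply/funext => v; have [x tx <-] := pr_surj v0 G_conn v.
  by have := congr1 (fun F => F x) E; rewrite /liftpr tx.
- move=> F [hF iF].
  (* A vertex [s v] is chosen over each [v]; by invariance and transitivity on fibres, [F] takes the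
     value [F (s v)] on the whole fibre. *)
  have [s sP] : {s : V -> seq (V * V) & forall v, tvert adj v0 (s v) /\ pr v0 (s v) = v}.
    apply: (@choice _ _ (fun v x => tvert adj v0 x /\ pr v0 x = v)) => v.
    by have [x] := pr_surj v0 G_conn v; exists x.
  have E : liftpr adj v0 (fun v => F (s v)) = F.
    apply/funext => x; rewrite /liftpr; case: ifP => [tx|/negbT nx]; last first.
      by case: hF => ->.
    have [ts ps] := sP (pr v0 x); have [g hg <-] := actT_transitive adj_sym tx ts (esym ps).
    exact: iF.
  exists (fun v => F (s v)) => //; apply/EqSigT_lift; by rewrite E.
Qed.
End Lift.
End Eigen.

(** * Finitely additive measures on the boundary *)

Section Boundary.
Set Implicit Arguments.
Unset Strict Implicit.
Unset Printing Implicit Defensive.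
Variables (V : finType) (adj : rel V) (v0 : V).
Hypothesis adj_sym : symmetric adj.
Hypothesis deg_ge2 : forall v : V, (2 <= deg adj v)%N.
Implicit Types (e : V * V) (c x y g : seq (V * V)) (w : seq (V * V) -> CC).
Implicit Types (p : nat -> V * V) (A B : bset V) (nu : bset V -> CC).
Local Notation ext := (extr adj v0).
Local Notation codeB := (codeB adj v0).
Local Notation distB := (distB adj v0).
Local Notation tvert := (tvert adj v0).
Local Notation ray := (ray adj v0).
Local Notation isumB := (isum codeB ext).
Local Notation clopen := (clopen adj v0).
Local Notation one := (fun _ : nat -> V * V => 1 : CC).

(** Additivity is separated from vanishing off clopen sets, since [actM] preserves the former but
    need not preserve the latter. *)
Definition addB nu := forall A B, clopen A -> clopen B ->
  (forall p, A p -> B p -> False) -> nu (fun p => A p \/ B p) = nu A + nu B.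

Lemma distB_ext c : codeB c -> distB c (ext c).
Proof. by move=> cc; split; [exact: extr_ray|exact: mkseq_extr]. Qed.

Lemma distB_extE c c' : codeB c -> codeB c' -> size c = size c' ->
  distB c' (ext c) <-> c = c'.
Proof.
move=> cc cc' sc; split=> [[_]|<-]; last exact: distB_ext.
by rewrite -sc mkseq_extr.
Qed.

Lemma bsum_isum w f m : wadd codeB w -> (0 < m)%N -> loc ray m f ->
  bsum adj v0 (depB adj v0 f) f w = isumB m f w.
Proof.
move=> aw m0 lf; apply: (@csum_cdepth _ codeB ray) => //.
- exact: codeB_rconsl.
- exact: ray_codeB.
- exact: extr_ray.
- by move=> c _; exact: mkseq_extr.
Qed.

Lemma eq_isumB m f1 f2 w1 w2 :
  (forall c, codeB c -> size c = m -> f1 (ext c) * w1 c = f2 (ext c) * w2 c) ->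
  isumB m f1 w1 = isumB m f2 w2.
Proof. exact: eq_csum. Qed.

(** A depth beyond all codes of the union decides membership; conversely there are finitely many
    codes of length [m], and those whose sample point lies in [A] form the required union. *)
Lemma clopenP A : clopen A <->
  (forall p, A p -> ray p) /\ exists2 m, (0 < m)%N & loc ray m A.
Proof.
split=> [[cs [/allP ccs _ ->]]|[Ar [m m0 lA]]].
  split; first by move=> p [c _ []].
  (* The successor keeps the depth positive when [cs] is empty. *)
  exists (\max_(c <- cs) size c).+1 => // p p' rp rp' E; apply/propext.
  have H q q' c : c \in cs -> ray q' -> mkseq q (\max_(c <- cs) size c).+1 =
      mkseq q' (\max_(c <- cs) size c).+1 -> distB c q -> distB c q'.
    move=> hc rq Eq [_ hq]; split=> //; rewrite -[RHS]hq; apply/esym.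
    apply: mkseq_le Eq; apply: leqW; exact: (@leq_bigmax_seq _ cs xpredT size c hc isT).
  by split=> -[c hc hp]; exists c => //; apply: H hp.
pose P (t : m.-tuple (V * V)) := codeB t && `[< A (ext t) >].
exists [seq val t | t <- enum {: m.-tuple (V * V)} & P t]; split.
- by apply/allP => c /mapP[t]; rewrite mem_filter => /andP[/andP[ct _] _] ->.
- move=> c1 c2 /mapP[t1 _ ->] /mapP[t2 _ ->] /eqP ne p [_ h1] [_ h2].
  by apply: ne; rewrite -h1 -h2 !size_tuple.
- apply/funext => p; apply/propext; split=> [Ap|[c /mapP[t]]].
    have rp := Ar _ Ap; have cc := ray_codeB rp m0.
    have sz : size (mkseq p m) == m by rewrite size_mkseq.
    exists (mkseq p m); last by split; rewrite ?size_mkseq.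
    apply/mapP; exists (Tuple sz) => //; rewrite mem_filter mem_enum andbT /P /= cc /=.
    apply/asboolP; rewrite (lA _ p) //; first exact: extr_ray.
    by have := mkseq_extr adj v0 (mkseq p m); rewrite size_mkseq.
  rewrite mem_filter => /andP[/andP[ct /asboolP At] _] -> [rp hp].
  rewrite (lA _ (ext t)) //; first exact: extr_ray.
  by have := mkseq_extr adj v0 t; rewrite -[RHS]hp size_tuple.
Qed.

Lemma clopen_distB c : codeB c -> clopen (distB c).
Proof.
move=> cc; apply/clopenP; split; first by move=> p [].
exists (size c); first by case: (c) cc.
by move=> p p' rp rp' E; apply/propext; rewrite /Defs.distB E; split=> -[].
Qed.

Lemma clopenU A B : clopen A -> clopen B -> clopen (fun p => A p \/ B p).
Proof.
move=> /clopenP[Ar [m m0 lA]] /clopenP[Br [n n0 lB]]; apply/clopenP; split.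
  by move=> p [/Ar|/Br].
exists (maxn m n); first by rewrite leq_max m0.
by move=> p p' rp rp' E; rewrite (lA p p') ?(lB p p') //;
  apply: mkseq_le E; rewrite ?leq_maxl ?leq_maxr.
Qed.

Lemma indB_loc m A f : loc ray m A -> loc ray m f -> loc ray m (indB A f).
Proof. by move=> lA lf p p' rp rp' E; rewrite /indB (lA p p') ?(lf p p'). Qed.

Lemma clopen_set0 : clopen (fun _ => False).
Proof. by apply/clopenP; split=> //; exists 1%N. Qed.

Lemma addB0 nu : addB nu -> nu (fun _ => False) = 0.
Proof.
move=> h; have := h _ _ clopen_set0 clopen_set0 (fun _ a _ => a).
have -> : (fun p : nat -> V * V => False \/ False) = (fun _ => False).
  by apply/funext => p; apply/propext; split=> // -[].
by move/eqP; rewrite -subr_eq subrr eq_sym => /eqP.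
Qed.

(** Clopenness is carried through the induction because additivity is available for clopen sets
    only. *)
Lemma addB_bigU nu m (s : seq (m.-tuple (V * V))) : addB nu -> uniq s ->
  (forall t, t \in s -> codeB t) ->
  clopen (fun p => exists2 t : m.-tuple (V * V), t \in s & distB t p) /\
  nu (fun p => exists2 t : m.-tuple (V * V), t \in s & distB t p) = \sum_(t <- s) nu (distB t).
Proof.
move=> h; elim: s => [|t s IH] /=.
  move=> _ _; rewrite big_nil (_ : (fun p => _) = (fun _ => False)).
    by split; [exact: clopen_set0|exact: addB0].
  by apply/funext => p; apply/propext; split=> // -[].
case/andP=> ts us cs; have [|IH1 IH2] := IH us.
  by move=> t' t's; apply: cs; rewrite inE t's orbT.
have ct : codeB t by apply: cs; rewrite mem_head.
have cd := clopen_distB ct.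
rewrite (_ : (fun p => _) =
  (fun p => distB t p \/ exists2 t : m.-tuple (V * V), t \in s & distB t p)).
  split; first exact: clopenU.
  rewrite big_cons -IH2 h // => p [_ ht] [t' t's [_ ht']].
  suff E : t = t' by rewrite E t's in ts.
  by apply/val_inj; rewrite /= -ht -ht' !size_tuple.
apply/funext => p; apply/propext; split.
  by case=> t'; rewrite inE => /predU1P[-> |t's]; [left|right; exists t'].
by case=> [|[t' t's]]; [exists t; rewrite ?mem_head|exists t'; rewrite // inE t's orbT].
Qed.

(** [A] is the disjoint union of the districts of depth [m] that meet it, so [nu] is determined by
    its values on districts. *)
Lemma addB_isum nu A m : addB nu -> clopen A -> (0 < m)%N -> loc ray m A ->
  nu A = isumB m (indB A one) (fun c => nu (distB c)).
Proof.
move=> h /clopenP[Ar _] m0 lA.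
pose P (t : m.-tuple (V * V)) := codeB t && `[< A (ext t) >].
have [||_] := @addB_bigU nu m (filter P (index_enum _)) h.
- by rewrite filter_uniq // index_enum_uniq.
- by move=> t; rewrite mem_filter => /andP[/andP[]].
rewrite big_filter big_mkcondr /= => E.
transitivity (nu (fun p =>
  exists2 t : m.-tuple (V * V), t \in filter P (index_enum _) & distB t p)).
  congr (nu _); apply/funext => p; apply/propext; split=> [Ap|[t]].
    have rp := Ar _ Ap; have cc := ray_codeB rp m0.
    have sz : size (mkseq p m) == m by rewrite size_mkseq.
    exists (Tuple sz); last by split; rewrite ?size_mkseq.
    rewrite mem_filter mem_index_enum andbT /P /= cc /=.
    apply/asboolP; rewrite (lA _ p) //; first exact: extr_ray.
    by have := mkseq_extr adj v0 (mkseq p m); rewrite size_mkseq.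
  rewrite mem_filter => /andP[/andP[ct /asboolP At] _] [rp hp].
  rewrite (lA _ (ext t)) //; first exact: extr_ray.
  by have := mkseq_extr adj v0 t; rewrite -[RHS]hp size_tuple.
rewrite {}E /isum /csum; apply: eq_bigr => t _; rewrite /indB.
by case: ifP => _; rewrite ?mul1r ?mul0r.
Qed.

Lemma loc_distB c m : (size c <= m)%N -> loc ray m (distB c).
Proof.
by move=> cm p p' rp rp' /(mkseq_le cm) E; apply/propext; rewrite /Defs.distB E; split=> -[].
Qed.

Lemma isum_distB c f w : codeB c -> isumB (size c) (indB (distB c) f) w = f (ext c) * w c.
Proof.
move=> cc; rewrite /isum -(csum_pick (fun c => f (ext c) * w c) cc).
apply: eq_csum => c' cc' sc; rewrite /indB.
have [->|ne] := eqVneq c' c; first by rewrite asboolT //; exact: distB_ext.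
rewrite asboolF ?mul0r // => /distB_extE E; case/eqP: ne; exact: E.
Qed.

Lemma addB_wadd nu : addB nu -> wadd codeB (fun c => nu (distB c)).
Proof.
move=> h c cc; have c0 : (0 < size c)%N by case: (c) cc.
rewrite (addB_isum h (clopen_distB cc) (m := (size c).+1)) //; last exact: loc_distB.
rewrite /isum csumS //; last exact: codeB_rconsl.
rewrite -[RHS](csum_pick (fun c => \sum_(e | codeB (rcons c e)) nu (distB (rcons c e))) cc).
apply: eq_csum => c' cc' sc; case: eqP => [->|ne].
  apply: eq_bigr => e ce; rewrite /indB asboolT ?mul1r //; split; first exact: extr_ray.
  have := mkseq_extr adj v0 (rcons c e); rewrite size_rcons mkseqS => /eqP.
  by rewrite eqseq_rcons => /andP[/eqP].
rewrite big1 // => e ce; rewrite /indB asboolF ?mul0r // => -[_ hd]; apply: ne.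
rewrite -hd -sc; have := mkseq_extr adj v0 (rcons c' e); rewrite size_rcons mkseqS => /eqP.
by rewrite eqseq_rcons => /andP[/eqP].
Qed.

Lemma bint_isum nu f m : addB nu -> (0 < m)%N -> loc ray m f ->
  bint adj v0 f nu = isumB m f (fun c => nu (distB c)).
Proof. by move=> h m0 lf; apply: bsum_isum => //; exact: addB_wadd. Qed.

Lemma Res_isum mu A m : wadd codeB mu -> clopen A -> (0 < m)%N -> loc ray m A ->
  Res adj v0 mu A = isumB m (indB A one) mu.
Proof.
by move=> amu cA m0 lA; rewrite /Res asboolT //; apply: bsum_isum => //; exact: indB_loc.
Qed.

Lemma Res_distB mu c : wadd codeB mu -> codeB c -> Res adj v0 mu (distB c) = mu c.
Proof.
move=> amu cc; rewrite (Res_isum amu (clopen_distB cc) (m := size c)).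
- by rewrite isum_distB // mul1r.
- by case: (c) cc.
- exact: loc_distB.
Qed.

Lemma Res_FAB mu : wadd codeB mu -> FAB adj v0 (Res adj v0 mu).
Proof.
move=> amu; split=> [A nA|A B cA cB dis]; first by rewrite /Res asboolF.
have /clopenP[_ [m m0 lA]] := cA; have /clopenP[_ [n n0 lB]] := cB.
have {}lA : loc ray (maxn m n) A by apply: loc_le lA; exact: leq_maxl.
have {}lB : loc ray (maxn m n) B by apply: loc_le lB; exact: leq_maxr.
have mn0 : (0 < maxn m n)%N by rewrite leq_max m0.
rewrite !(Res_isum (m := maxn m n)) //; last first.
- by move=> p p' rp rp' E; rewrite (lA p p') ?(lB p p').
- exact: clopenU.
rewrite -[isumB _ (indB A _) _]mul1r -[isumB _ (indB B _) _]mul1r -isum_linl.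
apply: eq_isumB => c _ _; congr (_ * _); rewrite /indB !mul1r.
case: (pselect (A (ext c))) => a; case: (pselect (B (ext c))) => b.
- by case: (dis _ a b).
- by rewrite (asboolT (or_introl a)) (asboolT a) (asboolF b) addr0.
- by rewrite (asboolT (or_intror b)) (asboolT b) (asboolF a) add0r.
- by rewrite asboolF ?(asboolF a) ?(asboolF b) ?addr0 // => -[].
Qed.

Lemma Res_unique nu mu : FAB adj v0 nu -> wadd codeB mu ->
  (forall c, codeB c -> nu (distB c) = mu c) -> Res adj v0 mu = nu.
Proof.
move=> [nu0 nuU] amu E; apply/funext => A.
case: (pselect (clopen A)) => cA; last by rewrite nu0 // /Res asboolF.
have /clopenP[_ [m m0 lA]] := cA.
rewrite (Res_isum amu cA m0 lA) (addB_isum nuU cA m0 lA).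
by apply: eq_isumB => c cc _; rewrite E.
Qed.

(** The depth depends on the set alone, so all three sums run over the same districts. *)
Lemma Res_linear a mu mu' : Res adj v0 (fun c => a * mu c + mu' c) =
  (fun A => a * Res adj v0 mu A + Res adj v0 mu' A).
Proof.
apply/funext => A; rewrite /Res; case: ifP => _; last by rewrite mulr0 addr0.
rewrite /bsum mulr_sumr -big_split; apply: eq_bigr => t _ /=.
by rewrite mulrDr mulrCA.
Qed.

Lemma Pz_linear z a nu nu' : Pz adj v0 z (fun A => a * nu A + nu' A) =
  (fun x => a * Pz adj v0 z nu x + Pz adj v0 z nu' x).
Proof.
apply/funext => x; rewrite /Pz; case: ifP => _; last by rewrite mulr0 addr0.
rewrite /bint /bsum mulr_sumr -big_split; apply: eq_bigr => t _ /=.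
by rewrite mulrDr mulrCA.
Qed.

End Boundary.

(** * Deck transformations on the boundary *)

Section Action.
Set Implicit Arguments.
Unset Strict Implicit.
Unset Printing Implicit Defensive.
Variables (V : finType) (adj : rel V) (v0 : V).
Hypothesis adj_sym : symmetric adj.
Hypothesis deg_ge2 : forall v : V, (2 <= deg adj v)%N.
Implicit Types (e : V * V) (c x y g : seq (V * V)) (mu : seq (V * V) -> CC).
Implicit Types (p : nat -> V * V) (A B : bset V) (nu : bset V -> CC).
Local Notation ext := (extr adj v0).
Local Notation codeB := (codeB adj v0).
Local Notation distB := (distB adj v0).
Local Notation tvert := (tvert adj v0).
Local Notation ray := (ray adj v0).
Local Notation isumB := (isum codeB ext).
Local Notation clopen := (clopen adj v0).
Local Notation isLoop := (isLoop adj v0).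

Lemma ray_tvert p N : ray p -> tvert (mkseq p N).
Proof. by case: N => // N rp; apply: codeB_tvert; exact: ray_codeB. Qed.

(** The definition of [actE] uses a different prefix of [p] for each index; by [red_cat_stable] any
    prefix of length at least [n + size g] gives the same first [n] edges. *)
Lemma actE_mkseq g p n N : ray p -> (n + size g <= N)%N ->
  mkseq (actE g p) n = take n (red (g ++ mkseq p N)).
Proof.
move=> rp nN; have rN M : reduced (mkseq p M) by exact: (tvert_reduced (ray_tvert _ rp)).
have szN := size_red_cat g (rN N); rewrite size_mkseq in szN.
have sz : size (take n (red (g ++ mkseq p N))) = n by rewrite size_takel //; lia.
apply: (@eq_from_nth _ (p 0%N)) => [|i]; first by rewrite size_mkseq sz.
rewrite size_mkseq => ni; rewrite nth_mkseq // nth_take // /actE.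
(* The prefix length used by [actE] at index [i]; the extra edge provides the strict inequality of
   [red_cat_stable]. *)
set M := (i + size g).+1; have MN : (M <= N)%N by rewrite /M; lia.
rewrite -(cat_take_drop M (mkseq p N)) take_mkseq // red_cat_stable.
- rewrite nth_cat; have sM := size_red_cat g (rN M); rewrite size_mkseq in sM.
  by rewrite ifT //; apply: leq_trans sM; rewrite /M -addSn addnK.
- by rewrite -(take_mkseq _ MN) cat_take_drop.
- by rewrite size_mkseq /M; lia.
Qed.

Lemma tvert_take x n : tvert x -> tvert (take n x).
Proof.
case: x n => [|e x] [|n] //; rewrite /Defs.tvert /= => /andP[/andP[-> p] ->].
by rewrite take_path.
Qed.

Lemma actE_tvert g p n : isLoop g -> ray p -> tvert (mkseq (actE g p) n).
Proof.
move=> hg rp; rewrite (actE_mkseq rp (leqnn _)); apply: tvert_take.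
by have [] := actT_tvert hg (ray_tvert (n + size g) rp).
Qed.

Lemma actE_ray g p : isLoop g -> ray p -> ray (actE g p).
Proof.
move=> hg rp; split=> [i|].
  have := actE_tvert i.+2 hg rp; rewrite mkseqS tvert_rcons mkseqS codeB_rcons2.
  by case/andP.
by have := actE_tvert 1 hg rp; rewrite -[mkseq _ 1]/(rcons [::] _) tvert_rcons codeB1;
  move=> /andP[_ /eqP].
Qed.

Lemma loc_preim T g m (f : (nat -> V * V) -> T) : isLoop g -> loc ray m f ->
  loc ray (m + size g) (f \o actE g).
Proof.
move=> hg lf p p' rp rp' E; apply: lf; try exact: actE_ray.
by rewrite !(actE_mkseq (N := m + size g)) // E.
Qed.

Lemma clopen_preim g A : isLoop g -> clopen A -> clopen (fun p => ray p /\ A (actE g p)).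
Proof.
move=> hg /clopenP[// |Ar [m m0 lA]]; apply/clopenP => //; split; first by move=> p [].
exists (m + size g)%N; first by rewrite addn_gt0 m0.
move=> p p' rp rp' E; have /= -> := loc_preim hg lA rp rp' E.
by apply/propext; split=> -[].
Qed.

Lemma actM_addB g nu : isLoop g -> addB adj v0 nu -> addB adj v0 (actM adj v0 g nu).
Proof.
move=> hg h A B cA cB dis; rewrite /actM -h; first last.
- by move=> p [_ a] [_]; exact: dis.
- exact: clopen_preim.
- exact: clopen_preim.
congr (nu _); apply/funext => p; apply/propext; split.
  by case=> rp [a|b]; [left|right].
by case=> -[rp a]; split=> //; [left|right].
Qed.

(** * Translating the district of x e to that of x' e *)

Section Translate.
Variables (g x x' : seq (V * V)) (e : V * V).
Hypotheses (hg : isLoop g) (cx : codeB (rcons x e)) (cx' : codeB (rcons x' e)).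
Hypothesis gx : actT g x = x'.

Lemma red_pinv_act : red (pinv g ++ x') = x.
Proof.
by apply: red_actP gx; exact: (tvert_reduced (codeB_rcons cx).1).
Qed.

(** [g] replaces the prefix [x] by [x'], and nothing cancels at the seam because both [rcons x' e]
    and [e :: t] are reduced. *)
Lemma red_act_cat t : reduced (rcons x e ++ t) -> red (g ++ rcons x e ++ t) = rcons x' e ++ t.
Proof.
rewrite !cat_rcons => rt; rewrite catA -red_catl -/(actT g x) gx red_id //.
apply: reduced_cat_mid; first exact: (tvert_reduced (codeB_tvert cx')).
by have [] := reduced_cat rt.
Qed.

Lemma red_pinv_act_cat t : reduced (rcons x' e ++ t) ->
  red (pinv g ++ rcons x' e ++ t) = rcons x e ++ t.
Proof.
rewrite !cat_rcons => rt; rewrite catA -red_catl red_pinv_act red_id //.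
apply: reduced_cat_mid; first exact: (tvert_reduced (codeB_tvert cx)).
by have [] := reduced_cat rt.
Qed.

Lemma preim_distB : (fun p => ray p /\ distB (rcons x' e) (actE g p)) = distB (rcons x e).
Proof.
apply/funext => p; apply/propext.
have H (rp : ray p) : mkseq (actE g p) (size (rcons x' e)) = rcons x' e <->
    mkseq p (size (rcons x e)) = rcons x e.
  (* Long enough to contain the prefix [rcons x e] and to determine the first [size (rcons x' e)]
     edges of the translate. *)
  pose N := (size (rcons x e) + (size (rcons x' e) + size g))%N.
  have ry : reduced (mkseq p N) by exact: (tvert_reduced (ray_tvert _ rp)).
  rewrite (actE_mkseq rp (N := N)) ?leq_addl //.
  rewrite -(take_mkseq p (leq_addr (size (rcons x' e) + size g) _ : _ <= N)%N).
  split=> E.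
    have Er := cat_take_drop (size (rcons x' e)) (red (g ++ mkseq p N)).
    rewrite E in Er; have Ey := red_actP ry (esym Er).
    have {}Ey := etrans (esym (red_pinv_act_cat _)) Ey.
    rewrite -Ey; first by rewrite take_size_cat.
    by rewrite Er; exact: reduced_red.
  have Ey := cat_take_drop (size (rcons x e)) (mkseq p N).
  rewrite E in Ey; rewrite -Ey red_act_cat ?take_size_cat //.
  by rewrite Ey.
split=> [[rp [_ /(H rp) E]]|[rp /(H rp) E]]; first by split.
by split=> //; split=> //; exact: actE_ray.
Qed.

Variable z : CC.
Hypothesis z0 : z != 0.

Lemma expz_subn m n : z ^ (m%:Z - n%:Z) = z ^+ m / z ^+ n.
Proof. by rewrite expfzDr // -invr_expz. Qed.

(** The exponent of [cgam] is |g| - 2 lcp(g, p). On this district the length of g^-1 applied to a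
    long prefix of [p] is known, so [red_pinv_lcp] evaluates it as |x| - |x'|. *)
Lemma cgam_distB p : distB (rcons x' e) p -> cgam z g p = z ^+ size x / z ^+ size x'.
Proof.
move=> [rp hp]; rewrite /cgam -expz_subn; congr (_ ^ _).
have tg : reduced g by case/andP: hg => /tvert_reduced.
rewrite /horo /actT cats0 (red_id tg) /= addn0.
pose N := (size g + size (rcons x' e))%N.
have ry : reduced (mkseq p N) by exact: (tvert_reduced (ray_tvert _ rp)).
have L : lcp g (mkseq p (size g)) = lcp g (mkseq p N).
  by rewrite -(take_mkseq p (leq_addr _ _ : size g <= N)%N) lcp_take.
have Ey := cat_take_drop (size (rcons x' e)) (mkseq p N).
rewrite take_mkseq ?leq_addl // hp in Ey.
have := red_pinv_lcp tg ry; rewrite -{1}Ey red_pinv_act_cat ?Ey // size_cat -L.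
rewrite size_drop !size_mkseq !size_rcons /N size_rcons => EL.
rewrite /dT size_mkseq [lcp [::] _]/=.
move: (lcp_le g (mkseq p (size g))) EL.
by move: (lcp g (mkseq p (size g))) (size g) (size x) (size x') => l a b b' /=; lia.
Qed.

End Translate.
End Action.

(** * Reachability of oriented edges *)

Section Reachability.
Set Implicit Arguments.
Unset Strict Implicit.
Unset Printing Implicit Defensive.
Variables (V : finType) (adj : rel V) (v0 : V).
Hypothesis adj_sym : symmetric adj.
Hypothesis deg_ge2 : forall v : V, (2 <= deg adj v)%N.
Implicit Types (e : V * V) (u v w : V).

Definition reach e : bool := `[< exists x, codeB adj v0 (rcons x e) >].

Lemma reach_isE e : reach e -> isE adj e.
Proof. by case/asboolP => x /codeB_isE. Qed.

Lemma reach_turn e e' : reach e -> turn adj e e' -> reach e'.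
Proof.
by case/asboolP => x cx t; apply/asboolP; exists (rcons x e); rewrite codeB_rcons2 cx.
Qed.

Lemma reach_v0 w : adj v0 w -> reach (v0, w).
Proof. by move=> h; apply/asboolP; exists [::]; rewrite codeB1 /isE /= h eqxx. Qed.

Definition rin v := [pred w | reach (w, v)].
Definition rout v := [pred w | reach (v, w)].

Lemma mem_rin v w : (w \in rin v) = reach (w, v). Proof. by []. Qed.
Lemma mem_rout v w : (w \in rout v) = reach (v, w). Proof. by []. Qed.

(** If two reachable edges enter [v], each neighbour of [v] is reached from one of them without
    backtracking. If only one enters, degree at least two gives it a continuation. *)
Lemma rin_le_rout v : (#|rin v| <= #|rout v|)%N.
Proof.
have [->//|] := posnP #|rin v|; case/card_gt0P => u; rewrite mem_rin => hu.
have auv : isE adj (u, v) := reach_isE hu.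
have out w : adj v w -> w != u -> w \in rout v.
  move=> aw ne; rewrite mem_rout; apply: reach_turn hu _.
  by rewrite /turn auv /isE /= aw eqxx /ebar xpair_eqE eqxx.
have [/existsP[u' /andP[hu' ne]]|] := boolP [exists u', (u' \in rin v) && (u' != u)].
  apply: subset_leq_card; apply/fintype.subsetP => w hw.
  have aw : adj v w by rewrite adj_sym; exact: (reach_isE hw).
  have [E|] := eqVneq w u; last exact: out.
  rewrite E mem_rout; apply: (reach_turn (e := (u', v))) => //.
  have auv' : isE adj (u', v) := reach_isE hu'.
  by rewrite /turn auv' /isE /= adj_sym (auv : adj u v) eqxx /ebar xpair_eqE eqxx eq_sym.
rewrite negb_exists => /forallP h.
have le1 : (#|rin v| <= 1)%N.
  rewrite -(card1 u); apply: subset_leq_card; apply/fintype.subsetP => w hw.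
  by have := h w; rewrite hw /= negbK.
apply: (leq_trans le1); apply/card_gt0P.
have t := turn_nexte deg_ge2 auv.
exists (nexte adj (u, v)).2; rewrite mem_rout; have := reach_turn hu t.
by case: (nexte adj (u, v)) t => a b /and4P[_ _ /eqP /= -> _].
Qed.

(* Both sides count the reachable oriented edges, so the inequality above is
   an equality at every vertex. *)
Lemma rin_rout v : #|rin v| = #|rout v|.
Proof.
have S (F : V -> V -> bool) : (\sum_v #|[pred w | F v w]| = \sum_v \sum_w F v w)%N.
  by apply: eq_bigr => u _; rewrite -sum1_card big_mkcond.
have E : (\sum_v #|rin v| = \sum_v #|rout v|)%N.
  by rewrite (S (fun v w => reach (w, v))) (S (fun v w => reach (v, w))) exchange_big.
apply/eqP; have /leqif_sum : forall i, true -> (#|rin i| <= #|rout i| ?= iff (#|rin i| == #|rout i|))%N.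
  by move=> i _; split=> //; exact: rin_le_rout.
by case=> _; rewrite E eqxx => /esym/forall_inP; apply.
Qed.

(** Reachability of all edges leaving a vertex spreads from [v0] along paths of the graph. From v to
    a neighbour u, the edge (v, u) continues to every edge leaving u except (u, v). *)
Lemma reach_all (G_conn : forall u v : V, connect adj u v) e : isE adj e -> reach e.
Proof.
(* If all outgoing edges are reachable, the equality of counts makes all incoming ones reachable;
   this covers the missing edge (u, v). *)
have full v : (forall w, adj v w -> reach (v, w)) -> forall w, adj v w -> reach (w, v).
  move=> h; have so : rout v =i [pred w | adj v w].
    by move=> w; rewrite mem_rout; apply/idP/idP => [/reach_isE|/h].
  have si : rin v \subset [pred w | adj v w].
    by apply/fintype.subsetP => w /reach_isE; rewrite /isE adj_sym.
  have /subset_cardP : #|rin v| = #|[pred w | adj v w]| by rewrite rin_rout; exact: eq_card.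
  by move=> /(_ si) E w aw; have := E w; rewrite mem_rin => ->.
have step v u : (forall w, adj v w -> reach (v, w)) -> adj v u ->
    forall w, adj u w -> reach (u, w).
  move=> h vu w uw; have [->|ne] := eqVneq w v; first exact: full.
  apply: (reach_turn (h _ vu)).
  by rewrite /turn /isE /= vu uw eqxx /ebar xpair_eqE eqxx.
have all v : forall w, adj v w -> reach (v, w).
  case/connectP: (G_conn v0 v) => p; have := reach_v0.
  elim: p v0 => [|u p IH] v' h /=; first by move=> _ ->.
  by case/andP => vu /IH; apply; exact: (step _ _ h).
by case: e => u v; exact: all.
Qed.

End Reachability.

(** * The Poisson transform *)

Section Poisson.
Set Implicit Arguments.
Unset Strict Implicit.
Unset Printing Implicit Defensive.
Variables (V : finType) (adj : rel V) (v0 : V) (z : CC).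
Hypothesis adj_sym : symmetric adj.
Hypothesis deg_ge2 : forall v : V, (2 <= deg adj v)%N.
Hypotheses (z0 : z != 0) (z1 : z != 1) (zN1 : z != -1).
Implicit Types (e : V * V) (c x y g : seq (V * V)) (mu : seq (V * V) -> CC).
Implicit Types (p : nat -> V * V) (A B : bset V) (nu : bset V -> CC).
Local Notation ext := (extr adj v0).
Local Notation codeB := (codeB adj v0).
Local Notation distB := (distB adj v0).
Local Notation tvert := (tvert adj v0).
Local Notation ray := (ray adj v0).
Local Notation isumB := (isum codeB ext).
Local Notation clopen := (clopen adj v0).
Local Notation isLoop := (isLoop adj v0).

(** The bracket equals 2 lcp(x, p) - |x|, hence depends on the first |x| edges of [p] only. *)
Lemma hbrE x p :
  z ^ hbr x p = z ^+ (2 * lcp x (mkseq p (size x))) / z ^+ size x.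
Proof.
rewrite -expz_subn //; congr (_ ^ _); rewrite /hbr /horo /dT /= size_mkseq.
move: (lcp_le x (mkseq p (size x))); rewrite ?add0n;
by move: (lcp x (mkseq p (size x))) (size x) => l n; lia.
Qed.

Lemma hbr_loc x m : (size x <= m)%N -> loc ray m (fun p => z ^ hbr x p).
Proof. by move=> xm p p' _ _ /(mkseq_le xm) E; rewrite !hbrE E. Qed.

Lemma hbr_rcons x e p : ray p -> z * z ^ hbr (rcons x e) p - z ^ hbr x p =
  z ^+ size x * (z ^+ 2 - 1) * indB (distB (rcons x e)) (fun _ => 1) p.
Proof.
move=> rp; rewrite !hbrE size_rcons mkseqS lcp_rcons ?size_mkseq // /indB.
have zn n : z ^+ n != 0 by rewrite expf_neq0.
case: eqP => E.
  have [Ex _] := rcons_inj E; rewrite -Ex asboolT; last first.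
    by split=> //; rewrite size_rcons mkseqS -E.
  have -> : lcp x x = size x by elim: (x) => //= a s ->; rewrite eqxx.
  rewrite (mulnC 2%N) (mulnC 2%N) !exprM (exprS z (size x)).
  by field; rewrite z0 zn.
rewrite asboolF; first by rewrite (exprS z (size x)); field; rewrite z0 zn.
by case=> _; rewrite size_rcons mkseqS => E'; apply: E.
Qed.

Lemma EigP_waddB mu : EigP adj z mu -> wadd codeB mu.
Proof.
case=> /FAP_wadd h _ c cc; rewrite h ?(codeB_code cc) //.
case/lastP: c cc => // c e cc.
by apply: eq_bigl => e'; rewrite code_rcons2 codeB_rcons2 cc (codeB_code cc).
Qed.

Lemma Pz_Res_isum mu x m : EigP adj z mu -> tvert x -> (size x <= m)%N -> (0 < m)%N ->
  Pz adj v0 z (Res adj v0 mu) x = isumB m (fun p => z ^ hbr x p) mu.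
Proof.
move=> hmu tx xm m0; have amu := EigP_waddB hmu.
have [_ ad] := Res_FAB deg_ge2 amu.
rewrite /Pz tx (bint_isum deg_ge2 ad m0 (hbr_loc xm)).
by apply: eq_csum => c cc _; rewrite Res_distB.
Qed.

(** Induction along tree vertices: at the root both sides sum mu over the edges leaving [v0], and
    along an edge both obey the same recursion. *)
Lemma Pz_Res mu : EigP adj z mu ->
  liftpr adj v0 (Iop adj (fmu mu)) = Pz adj v0 z (Res adj v0 mu).
Proof.
move=> hmu; apply/funext => x; rewrite /liftpr; case: ifP => [|nx]; last by rewrite /Pz nx.
have hg := fmu_EqS v0 adj_sym deg_ge2 hmu.
elim/last_ind: x => [|x e IH] tx.
  rewrite (Pz_Res_isum (m := 1) hmu) // /isum csum1 /= /Iop /fmu.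
  rewrite (sum_ebar _ (fun e => mu [:: e])); apply: eq_big => [e|e ce].
    by rewrite isE_ebar // andbT.
  by rewrite hbrE muln0 divr1 mul1r.
have ce : codeB (rcons x e) by rewrite -tvert_rcons.
have [tx' px] := codeB_rcons ce; have he := codeB_isE ce.
have he' : isE adj (ebar e) by rewrite isE_ebar.
apply: (mulfI z0); rewrite pr_rcons.
have H : z * Iop adj (fmu mu) e.2 - Iop adj (fmu mu) e.1 = (z ^+ 2 - 1) * mu [:: e].
  rewrite (Iop_eq adj_sym hg he' : Iop _ _ e.2 = _) (Iop_eq adj_sym hg he) ebarK.
  by rewrite (_ : mu [:: e] = fmu mu (ebar e)) ?/fmu ?ebarK //; ring.
rewrite -[LHS](subrK (Iop adj (fmu mu) e.1)) H -px IH // {IH H}.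
rewrite !(Pz_Res_isum (m := (size x).+1) hmu) ?size_rcons //.
apply/eqP; rewrite eq_sym -subr_eq; apply/eqP.
rewrite -[isumB _ (fun p => z ^ hbr x p) _]mul1r -mulNr -isum_linl.
(* The summand 0 * 0 gives the integrand the shape of [isum_linl], which then pulls out the
   constant. *)
transitivity (isumB (size x).+1 (fun p => z ^+ size x * (z ^+ 2 - 1) *
    indB (distB (rcons x e)) (fun _ => 1) p + 0 * 0) mu).
  apply: eq_isumB => c cc _; congr (_ * _).
  by rewrite mul0r addr0 -hbr_rcons ?mulN1r //; exact: extr_ray.
rewrite (isum_linl _ _ _ _ _ (indB _ _) (fun _ => 0)) mul0r addr0.
rewrite -(size_rcons x e) isum_distB // mul1r.
by rewrite (EigP_rcons v0 deg_ge2 hmu (codeB_code ce)) mulrA [_ * z ^+ _]mulrC.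
Qed.

(** * Invariant boundary measures and eigenmeasures *)

Lemma cgam_loc g m : isLoop g -> (size g <= m)%N -> loc ray m (cgam z g).
Proof.
move=> hg gm p p' _ _ /(mkseq_le gm) E; rewrite /cgam /horo /actT cats0.
by rewrite red_id ?addn0 ?E //; case/andP: hg => /tvert_reduced.
Qed.

Lemma piz_isum g nu A m : isLoop g -> addB adj v0 nu -> (0 < m)%N ->
  loc ray m (indB A (cgam z g)) ->
  piz adj v0 z g nu A = isumB m (indB A (cgam z g)) (fun c => actM adj v0 g nu (distB c)).
Proof.
by move=> hg anu m0 l; apply: bint_isum => //; exact: actM_addB.
Qed.

(** Since [x'] is at least as long as [g], the last edge [e] survives translation by g^-1. *)
Lemma act_preimage g x' e : isLoop g -> codeB (rcons x' e) -> (size g <= size x')%N ->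
  exists2 x, codeB (rcons x e) & actT g x = x'.
Proof.
move=> hg cx' gx'; have rx' := tvert_reduced (codeB_tvert cx').
have [u E] := red_cat_drop (pinv g) rx'.
rewrite size_pinv drop_rcons // -(rcons_cat e u) in E; set x := u ++ _ in E.
have [tx _] : tvert (rcons x e) /\ pr v0 (rcons x e) = e.2.
  rewrite -E -(pr_rcons v0 x' e); apply: epath_tvert; first exact: reduced_red.
  apply/epath_red/(epath_cat _ (tvert_epath (codeB_tvert cx'))).
  by apply: epath_pinv => //; exact: isLoop_epath.
exists x; first by rewrite -tvert_rcons.
(* Appending [ebar e] strips the last edge, which turns the identity for [rcons x' e] into one for
   [x']. *)
have cancel s : reduced s -> red (rcons s e ++ [:: ebar e]) = s.
  move=> rs; rewrite cat_rcons -red_catr /= eqxx cats0; exact: red_id.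
have Ex : red (pinv g ++ x') = x.
  rewrite -(cancel x) ?(reduced_rcons (tvert_reduced tx)) // -E red_catl -catA.
  by rewrite -[RHS]red_catr (cancel x') // (reduced_rcons rx').
rewrite /actT -[g]pinvK; apply: red_actP Ex; exact: reduced_rcons rx'.
Qed.

(** On districts deep enough for [act_preimage], the density z^(|x| - |x'|) matches the relation
    z^|x| mu(xe) = mu(e) = z^|x'| mu(x'e). *)
Lemma Res_inv mu : EigP adj z mu -> FABinv adj v0 z (Res adj v0 mu).
Proof.
move=> hmu; have amu := EigP_waddB hmu; have hF := Res_FAB deg_ge2 amu.
split=> // g hg A cA; have /(clopenP v0 deg_ge2)[_ [n n0 lA]] := cA.
pose m := (n + size g).+1.
have {}lA : loc ray m A by apply: loc_le lA; rewrite /m; lia.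
have lc : loc ray m (cgam z g) by apply: cgam_loc => //; rewrite /m; lia.
rewrite (piz_isum hg hF.2 (isT : (0 < m)%N)); last exact: indB_loc.
rewrite (Res_isum deg_ge2 amu cA (isT : (0 < m)%N) lA).
apply: eq_isumB => c; case/lastP: c => // x' e cx'; rewrite size_rcons => -[sx].
rewrite /indB; case: ifP => _; last by rewrite !mul0r.
have [|x cx gx] := act_preimage hg cx'; first by rewrite sx leq_addl.
rewrite /actM (preim_distB hg cx cx' gx) Res_distB // mul1r.
rewrite (cgam_distB hg cx cx' gx z0); last exact: distB_ext.
have := EigP_rcons v0 deg_ge2 hmu (codeB_code cx).
rewrite (EigP_rcons v0 deg_ge2 hmu (codeB_code cx')) => E.
by rewrite mulrAC -E mulrAC divff ?mul1r // expf_neq0.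
Qed.

(** Invariance is tested on the district of [rcons x' e] with a deck transformation taking [x] to
    [x']. *)
Lemma FABinv_end nu x x' e : FABinv adj v0 z nu -> codeB (rcons x e) -> codeB (rcons x' e) ->
  z ^+ size x * nu (distB (rcons x e)) = z ^+ size x' * nu (distB (rcons x' e)).
Proof.
case=> [[_ anu] inv] cx cx'.
have [tx px] := codeB_rcons cx; have [tx' px'] := codeB_rcons cx'.
have [g hg gx] := actT_transitive adj_sym tx tx' (etrans px (esym px')).
rewrite -(inv g hg _ (clopen_distB deg_ge2 cx')).
rewrite (piz_isum (m := size (rcons x' e)) hg anu).
- rewrite isum_distB // /actM (preim_distB hg cx cx' gx).
  rewrite (cgam_distB hg cx cx' gx z0); last exact: distB_ext.
  by rewrite mulrCA mulrA mulrVK // unitfE expf_neq0.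
- by rewrite size_rcons.
- move=> p p' rp rp' E; rewrite /indB (loc_distB (leqnn _) rp rp' E).
  case: asboolP => // h'; have h : distB (rcons x' e) p by rewrite (loc_distB (leqnn _) rp rp' E).
  by rewrite !(cgam_distB hg cx cx' gx z0).
Qed.

Lemma Res_surj (G_conn : forall u v : V, connect adj u v) nu : FABinv adj v0 z nu ->
  exists2 mu, EigP adj z mu & Res adj v0 mu = nu.
Proof.
move=> hnu; have [s sP] : {s & forall e, isE adj e -> codeB (rcons (s e) e)}.
  apply: (@choice _ _ (fun e x => isE adj e -> codeB (rcons x e))) => e.
  have [he|_] := boolP (isE adj e); last by exists [::].
  by have /asboolP[x cx] := reach_all v0 adj_sym deg_ge2 G_conn he; exists x.
(* By [EigP_rcons], the value that the sought eigenmeasure must take on [[:: e]]. *)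
pose a e := z ^+ size (s e) * nu (distB (rcons (s e) e)).
have aE x e : codeB (rcons x e) -> a e = z ^+ size x * nu (distB (rcons x e)).
  by move=> cx; apply: FABinv_end => //; exact/sP/codeB_isE/cx.
pose g e := if isE adj e then a (ebar e) else 0.
have hg : EqS adj z g.
  split=> e he; first by rewrite /g (negbTE he).
  have ce : codeB (rcons (s (ebar e)) (ebar e)) by apply: sP; rewrite isE_ebar.
  (* Additivity of [nu] on the chosen district gives S g = z g: the factor z raises the exponent to
     the length of the prefix preceding the new last edge. *)
  rewrite {2}/g he /a (addB_wadd deg_ge2 hnu.1.2 ce) mulrA -exprS mulr_sumr.
  rewrite /Sop [RHS](eq_bigl (turn adj (ebar e))); last by move=> e'; rewrite codeB_rcons2 ce.
  under [RHS]eq_bigr => e' te.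
    rewrite -(size_rcons _ (ebar e)) -aE; last by rewrite codeB_rcons2 ce.
    over.
  transitivity (\sum_(e' | turn adj e' e) a (ebar e')).
    by apply: eq_bigr => e' /and4P[he' _ _ _]; rewrite /g he'.
  rewrite (sum_ebar (fun e' => turn adj e' e) a); apply: eq_bigl => e'.
  by rewrite -{1}[e]ebarK turn_ebar.
have [hmu _] := mu_of_EigP v0 adj_sym deg_ge2 z0 hg.
exists (mu_of adj v0 z g) => //; apply: Res_unique => //; first by case: hnu.
  exact: EigP_waddB.
move=> c; case/lastP: c => // x e cx.
rewrite /mu_of (codeB_code cx) size_rcons last_rcons /= /g isE_ebar // (codeB_isE cx).
by rewrite ebarK (aE x) // mulKf // expf_neq0.
Qed.

End Poisson.

(** * Composing the isomorphisms around the diagram *)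

Theorem mainTheorem20 (V : finType) (adj : rel V) (v0 : V) (z : CC)
  (adj_sym : symmetric adj) (adj_irr : irreflexive adj)
  (G_conn : forall u v : V, connect adj u v)
  (deg_ge2 : forall v : V, (2 <= deg adj v)%N)
  (z0 : z != 0) (z1 : z != 1) (zN1 : z != -1) :
  lin_iso (EigP adj z) (EqS adj z) (@fmu V) /\
      lin_iso (EqS adj z) (EqSig adj z) (Iop adj) /\
      (forall f : V -> CC, EqSig adj z f <-> EqDel adj z f) /\
      lin_iso (EqSig adj z)
              (fun F => EqSigT adj v0 z F /\ GinvT adj v0 F) (liftpr adj v0) /\
      lin_iso (EigP adj z) (FABinv adj v0 z) (Res adj v0) /\
      lin_iso (FABinv adj v0 z)
              (fun F => EqSigT adj v0 z F /\ GinvT adj v0 F) (Pz adj v0 z) /\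
      (forall mu, EigP adj z mu ->
        liftpr adj v0 (Iop adj (fmu mu)) = Pz adj v0 z (Res adj v0 mu)).
Proof.
have Hlift := lin_iso_lift v0 z adj_sym G_conn.
have Hfmu := lin_iso_fmu v0 adj_sym deg_ge2 z0.
have HI := lin_iso_Iop adj_sym z0 z1 zN1.
have diag mu : EigP adj z mu -> liftpr adj v0 (Iop adj (fmu mu)) = Pz adj v0 z (Res adj v0 mu).
  exact: Pz_Res.
have Rs nu : FABinv adj v0 z nu -> exists2 mu, EigP adj z mu & Res adj v0 mu = nu.
  exact: Res_surj.
have [fmu1 _ fmu3 fmu4] := Hfmu; have [I1 _ I3 I4] := HI.
have [l1 _ l3 l4] := Hlift.
(* By the diagram this composite is also the lift of I f_mu, a composite of three injective maps.
   Injectivity of [Res], and of [Pz] since [Res] is onto, follows. *)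
have inj mu mu' : EigP adj z mu -> EigP adj z mu' ->
    Pz adj v0 z (Res adj v0 mu) = Pz adj v0 z (Res adj v0 mu') -> mu = mu'.
  move=> h h'; rewrite -!diag // => E; have [f1 f2] := (fmu1 _ h, fmu1 _ h').
  by apply: fmu3 => //; apply: I3 => //; apply: l3 => //; exact: I1.
split=> //; split=> //; split; first exact: EqSig_EqDel.
split=> //; split; [split|split=> //; split].
- by move=> mu; exact: Res_inv.
- by move=> a mu mu' _ _; exact: Res_linear.
- by move=> mu mu' h h' E; apply: inj; rewrite ?E.
- exact: Rs.
- by move=> nu /Rs[mu h <-]; rewrite -diag //; exact/l1/I1/fmu1.
- by move=> a nu nu' _ _; exact: Pz_linear.
- move=> nu nu' /Rs[mu h <-] /Rs[mu' h' <-] E; congr (Res _ _ _); exact: inj.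
(* [F] is pulled back through the lift, [Iop] and [fmu] to an eigenmeasure, whose restriction is the
   preimage. *)
- move=> F /l4[f /I4[g /fmu4[mu h <-] <-] <-]; exists (Res adj v0 mu); last by rewrite diag.
  exact: Res_inv.
Qed.
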